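(* Let $X$ be a finite connected simplicial complex of dimension at least $1$, and fix $n\ge2$. Then the strand map $\iota_*:\mathbb P_n(X,\mathbf x^0)\to\prod_{i=1}^n\pi_1(X,x_i^0)$ is surjective if and only if $X\not\cong S^1$.
   Context: $F_n(X)=\{(x_1,\dots,x_n)\in X^n: x_i\ne x_j\text{ for }i\ne j\}$, $\mathbf x^0=(x_1^0,\dots,x_n^0)\in F_n(X)$ is a basepoint, $\mathbb P_n(X,\mathbf x^0)=\pi_1(F_n(X),\mathbf x^0)$, and $\iota_*$ is the homomorphism induced by the inclusion $F_n(X)\hookrightarrow X^n$ (sending a pure braid to the tuple of homotopy classes of its strands). *)

(* Defs.v *)
From HB Require Import structures.
From mathcomp Require Import all_boot all_order all_algebra generic_quotient.
From mathcomp Require Import lra.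
From mathcomp Require Import all_classical all_reals all_analysis.
From mathcomp Require Import homotopy.

Set Implicit Arguments.
Unset Strict Implicit.
Unset Printing Implicit Defensive.

Import Order.TTheory GRing.Theory Num.Theory.
Import numFieldNormedType.Exports.

Local Open Scope classical_set_scope.
Local Open Scope ring_scope.
Local Open Scope quotient_scope.

(** Finite abstract simplicial complexes; the elements of [V] need not all be
    vertices of the complex. *)
Record simplicial_complex (V : finType) := SimplicialComplex {
  simplices :> {set {set V}};
  simplex_neq0 : forall s : {set V}, s \in simplices -> s != finset.set0;
  simplex_sub : forall s t : {set V},
    s \in simplices -> t != finset.set0 -> t \subset s -> t \in simplices
}.

Definition complex_dim (V : finType) (K : simplicial_complex V) : nat :=
  \max_(s in simplices K) #|s|.-1.

(** Points of the realization are given by their barycentric coordinates. *)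
Definition realization (R : realType) (V : finType) (K : simplicial_complex V)
    : set {ptws V -> R} :=
  [set a | [/\ forall v, 0 <= a v, \sum_v a v = 1
             & [set v | a v != 0]%SET \in simplices K]].

Definition circle (R : realType) : set (R * R) :=
  [set p | p.1 ^+ 2 + p.2 ^+ 2 = 1].

Arguments realization R {V} K.
Arguments circle R : clear implicits.

Definition homeomorphic (X Y : topologicalType) : Prop :=
  exists f : X -> Y, exists g : Y -> X,
    [/\ continuous f, continuous g, cancel f g & cancel g f].

Definition unit_itv (R : realType) : Type := set_type (`[0, 1]%classic : set R).

HB.instance Definition _ (R : realType) :=
  Topological.copy (unit_itv R) (set_type (`[0, 1]%classic : set R)).

Section unit_itv.
Context {R : realType}.
Local Notation I := (unit_itv R).

Lemma clamp_subproof (r : R) :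
  Num.max 0 (Num.min 1 r) \in (`[0, 1]%classic : set R).
Proof.
by rewrite inE /= in_itv /= le_max lexx ge_max ler01 ge_min lexx.
Qed.

Definition clamp (r : R) : I := SigSub (clamp_subproof r).

Definition uval (t : I) : R := set_val t.

Lemma uval_clamp r : uval (clamp r) = Num.max 0 (Num.min 1 r).
Proof. by []. Qed.

Lemma uval_clamp_id (r : R) : 0 <= r -> r <= 1 -> uval (clamp r) = r.
Proof. by move=> r0 r1; rewrite uval_clamp (min_idPr r1) (max_idPr r0). Qed.

Lemma uval_inj : injective uval.
Proof. exact: val_inj. Qed.

Lemma uval_ge0 t : 0 <= uval t.
Proof. by have := set_valP t; rewrite /= in_itv /= => /andP[]. Qed.

Lemma uval_le1 t : uval t <= 1.
Proof. by have := set_valP t; rewrite /= in_itv /= => /andP[]. Qed.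

Lemma uvalK : cancel uval clamp.
Proof.
move=> t; apply: uval_inj; rewrite uval_clamp.
by rewrite (min_idPr (uval_le1 t)) (max_idPr (uval_ge0 t)).
Qed.

Lemma clamp01_neq : clamp 0 != clamp 1.
Proof.
apply/eqP => /(congr1 uval); rewrite !uval_clamp minxx.
by rewrite (min_idPr ler01) maxxx (max_idPr ler01) => /eqP; rewrite eq_sym oner_eq0.
Qed.

HB.instance Definition _ := isBiPointed.Build I clamp01_neq.

Lemma uval_zero : uval zero = 0.
Proof. by rewrite /zero /= uval_clamp (min_idPr ler01) maxxx. Qed.

Lemma uval_one : uval one = 1.
Proof. by rewrite /one /= uval_clamp minxx (max_idPr ler01). Qed.

Lemma uval_continuous : continuous uval.
Proof. exact: initial_continuous. Qed.

Lemma clamp_continuous : continuous clamp.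
Proof.
apply: continuous_comp_initial => r.
apply: continuous_max; first exact: cvg_cst.
by apply: continuous_min; [exact: cvg_cst|exact: cvg_id].
Qed.

End unit_itv.

Section continuity.
Context {R : realType}.
Local Notation I := (unit_itv R).

Lemma continuous_pair (S T U : topologicalType) (f : S -> T) (g : S -> U) :
  continuous f -> continuous g -> continuous (fun x => (f x, g x)).
Proof. by move=> cf cg x; exact: (cvg_pair (cf x) (cg x)). Qed.

Lemma continuous_if (T Y : topologicalType) (h : T -> R) (c : R)
    (f g : T -> Y) :
  continuous h -> continuous f -> continuous g ->
  (forall t, h t = c -> f t = g t) ->
  continuous (fun t => if h t <= c then f t else g t).
Proof.
move=> ch cf cg fg t U /=; case: (ltgtP (h t) c) => htc nU.
- have hlt : \forall s \near t, h s < c.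
    have nc : nbhs (h t) [set x | x < c].
      by apply: open_nbhs_nbhs; split=> //; exact: open_lt.
    exact: (ch t _ nc).
  have := cf t U nU; apply: filterS2 hlt => s hs fU /=.
  by rewrite (ltW hs).
- have hgt : \forall s \near t, c < h s.
    have nc : nbhs (h t) [set x | c < x].
      by apply: open_nbhs_nbhs; split=> //; exact: open_gt.
    exact: (ch t _ nc).
  have := cg t U nU; apply: filterS2 hgt => s hs gU /=.
  by rewrite leNgt hs.
- suff : \forall s \near t, U (if h s <= c then f s else g s) by [].
  have gU : nbhs (g t) U by rewrite -fg.
  have nf : \forall s \near t, U (f s) by exact: (cf t U nU).
  have ng : \forall s \near t, U (g s) by exact: (cg t U gU).
  apply: filterS2 nf ng => s fUs gUs /=.
  by case: ifP.
Qed.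

Lemma continuous_fst (T U : topologicalType) : continuous (@fst T U).
Proof. by move=> x; exact: cvg_fst. Qed.

Lemma continuous_snd (T U : topologicalType) : continuous (@snd T U).
Proof. by move=> x; exact: cvg_snd. Qed.

Lemma comp_continuous (S T U : topologicalType) (g : T -> U) (f : S -> T) :
  continuous g -> continuous f -> continuous (fun x => g (f x)).
Proof.
by move=> cg cf x; apply: (@continuous_comp _ _ _ f g); [exact: cf|exact: cg].
Qed.

Lemma addr_continuous (T : topologicalType) (f g : T -> R) :
  continuous f -> continuous g -> continuous (fun t => f t + g t).
Proof. by move=> cf cg t; exact: (cvgD (cf t) (cg t)). Qed.

Lemma oppr_continuous (T : topologicalType) (f : T -> R) :
  continuous f -> continuous (fun t => - f t).
Proof. by move=> cf t; exact: (cvgN (cf t)). Qed.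

Lemma mulr_continuous (T : topologicalType) (f g : T -> R) :
  continuous f -> continuous g -> continuous (fun t => f t * g t).
Proof. by move=> cf cg t; exact: (cvgM (cf t) (cg t)). Qed.

Lemma minr_continuous (T : topologicalType) (f g : T -> R) :
  continuous f -> continuous g -> continuous (fun t => Num.min (f t) (g t)).
Proof. by move=> cf cg t; exact: (@continuous_min _ _ f g t (cf t) (cg t)). Qed.

Lemma maxr_continuous (T : topologicalType) (f g : T -> R) :
  continuous f -> continuous g -> continuous (fun t => Num.max (f t) (g t)).
Proof. by move=> cf cg t; exact: (@continuous_max _ _ f g t (cf t) (cg t)). Qed.

Lemma cstr_continuous (T U : topologicalType) (c : U) :
  continuous (fun _ : T => c).
Proof. by move=> t; exact: cvg_cst. Qed.

End continuity.

Ltac continuous_step f :=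
  lazymatch f with
  | fun x => Num.min _ _ => apply: minr_continuous
  | fun x => Num.max _ _ => apply: maxr_continuous
  | fun x => (- _)%R => apply: oppr_continuous
  | fun x => (_ + _)%R => apply: addr_continuous
  | fun x => (_ * _)%R => apply: mulr_continuous
  | fun x => (_, _) => apply: continuous_pair
  | fun x => clamp x => exact: clamp_continuous
  | fun x => clamp _ => apply: (comp_continuous clamp_continuous)
  | fun x => uval x => exact: uval_continuous
  | fun x => uval _ => apply: (comp_continuous uval_continuous)
  | fun x => fst x => exact: continuous_fst
  | fun x => snd x => exact: continuous_snd
  | fun x => fst _ => apply: (comp_continuous (@continuous_fst _ _))
  | fun x => snd _ => apply: (comp_continuous (@continuous_snd _ _))
  | fun _ => ?c => exact: cstr_continuous
  | @uval _ => exact: uval_continuous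
  | @clamp _ => exact: clamp_continuous
  | @fst _ _ => exact: continuous_fst
  | @snd _ _ => exact: continuous_snd
  | fun x => ?g _ => first
      [ assumption
      | match goal with g_cont : _ |- _ =>
          apply: (comp_continuous (g := g) g_cont) end
      | exact: cts_fun
      | apply: (comp_continuous (g := g) cts_fun) ]
  | _ => first [ assumption | exact: cts_fun ]
  end.

Ltac solve_continuous :=
  repeat match goal with
  | |- context [continuous_at _ ?f] => continuous_step f
  end.

Ltac no_extremum e :=
  lazymatch e with
  | context [Num.min _ _] => fail
  | context [Num.max _ _] => fail
  | _ => idtac
  end.

(** Splits on the comparisons in the goal, innermost first, and discards the
    impossible cases. *)
Ltac interval_cases :=
  repeat (match goal with
  | |- context [(?a <= ?b)%R] =>
      no_extremum a; no_extremum b; case: (lerP a b) => ?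
  | |- context [Num.min ?a ?b] =>
      no_extremum a; no_extremum b; case: (lerP a b) => ?
  | |- context [Num.max ?a ?b] =>
      no_extremum a; no_extremum b; case: (lerP a b) => ?
  end; try (exfalso; lra)).

Section path_homotopy.
Context {R : realType} {X : topologicalType}.
Local Notation I := (unit_itv R).

Definition path_homotopy (x y : X) (p q : I -> X) (H : I * I -> X) : Prop :=
  [/\ continuous H,
      forall s, H (s, zero) = p s,
      forall s, H (s, one) = q s,
      forall t, H (zero, t) = x
    & forall t, H (one, t) = y].

Definition path_homotopic (x y : X) (p q : I -> X) : Prop :=
  exists H : I * I -> X, path_homotopy x y p q H.

Lemma path_homotopic_reparam (f : I -> X) (phi psi : I -> R) :
  continuous f -> continuous phi -> continuous psi ->
  phi zero = psi zero -> phi one = psi one ->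
  path_homotopic (f (clamp (phi zero))) (f (clamp (phi one)))
    (f \o clamp \o phi) (f \o clamp \o psi).
Proof.
move=> cf cphi cpsi e0 e1.
exists (fun st => f (clamp (phi st.1 * (1 - uval st.2) + psi st.1 * uval st.2))).
split=> [|s|s|t|t] /=.
- by solve_continuous.
- by rewrite uval_zero subr0 mulr1 mulr0 addr0.
- by rewrite uval_one subrr mulr0 mulr1 add0r.
- by rewrite -e0 -mulrDr subrK mulr1.
- by rewrite -e1 -mulrDr subrK mulr1.
Qed.

Lemma path_homotopic_refl (x y : X) (p : {path I from x to y}) :
  path_homotopic x y p p.
Proof.
exists (p \o fst); split=> //= [|t|t]; last 2 first.
- exact: path_zero.
- exact: path_one.
by apply: comp_continuous; solve_continuous.
Qed.

Lemma path_homotopic_sym (x y : X) (p q : I -> X) :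
  path_homotopic x y p q -> path_homotopic x y q p.
Proof.
move=> [H [cH H0 H1 Hx Hy]].
exists (fun st => H (st.1, clamp (1 - uval st.2))); split=> //= [|s|s].
- by apply: comp_continuous => //; solve_continuous.
- by rewrite uval_zero subr0.
- by rewrite uval_one subrr.
Qed.

Lemma path_homotopic_trans (x y : X) (p q r : I -> X) :
  path_homotopic x y p q -> path_homotopic x y q r -> path_homotopic x y p r.
Proof.
move=> [H [cH H0 H1 Hx Hy]] [K [cK K0 K1 Kx Ky]].
exists (fun st => if uval st.2 <= 2^-1 then H (st.1, clamp (2 * uval st.2))
                  else K (st.1, clamp (2 * uval st.2 - 1))).
split=> /= [|s|s|t|t].
- apply: continuous_if.
  + by solve_continuous.
  + by apply: comp_continuous => //; solve_continuous.
  + by apply: comp_continuous => //; solve_continuous.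
  + by move=> [s t] /= ->; rewrite divff // subrr H1 K0.
- by rewrite uval_zero invr_ge0 ler0n mulr0 H0.
- rewrite uval_one ifF; last by apply/negbTE; rewrite -ltNge; lra.
  by rewrite mulr1 (_ : 2 - 1 = 1) ?K1 //; lra.
- by rewrite Hx Kx if_same.
- by rewrite Hy Ky if_same.
Qed.

Definition path_cat (p q : I -> X) : I -> X := fun t =>
  if uval t <= 2^-1 then p (clamp (2 * uval t)) else q (clamp (2 * uval t - 1)).

Definition path_inv (p : I -> X) : I -> X := fun t => p (clamp (1 - uval t)).

Lemma path_cat_clamp (p q : I -> X) (r : R) : 0 <= r -> r <= 1 ->
  path_cat p q (clamp r) =
  if r <= 2^-1 then p (clamp (2 * r)) else q (clamp (2 * r - 1)).
Proof. by move=> r0 r1; rewrite /path_cat uval_clamp_id. Qed.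

Section path_ops.
Context {x y z : X}.
Variables (p : {path I from x to y}) (q : {path I from y to z}).

Lemma path_cat_continuous : continuous (path_cat p q).
Proof.
apply: continuous_if.
- by solve_continuous.
- by apply: comp_continuous; solve_continuous.
- by apply: comp_continuous; solve_continuous.
- move=> t ->; rewrite divff // subrr.
  by rewrite -/one -/zero path_one path_zero.
Qed.

Lemma path_cat_zero : path_cat p q zero = x.
Proof.
by rewrite /path_cat uval_zero invr_ge0 ler0n mulr0 -/zero path_zero.
Qed.

Lemma path_cat_one : path_cat p q one = z.
Proof.
rewrite /path_cat uval_one ifF; last by apply/negbTE; rewrite -ltNge; lra.
by rewrite mulr1 (_ : 2 - 1 = 1) ?path_one //; lra.
Qed.

HB.instance Definition _ :=
  isContinuous.Build I X (path_cat p q) path_cat_continuous.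
HB.instance Definition _ :=
  isPath.Build I X x z (path_cat p q) path_cat_zero path_cat_one.

Lemma path_inv_continuous : continuous (path_inv p).
Proof. by apply: comp_continuous; solve_continuous. Qed.

Lemma path_inv_zero : path_inv p zero = y.
Proof. by rewrite /path_inv uval_zero subr0 path_one. Qed.

Lemma path_inv_one : path_inv p one = x.
Proof. by rewrite /path_inv uval_one subrr path_zero. Qed.

HB.instance Definition _ :=
  isContinuous.Build I X (path_inv p) path_inv_continuous.
HB.instance Definition _ :=
  isPath.Build I X y x (path_inv p) path_inv_zero path_inv_one.

End path_ops.

Lemma path_homotopic_cat (x y z : X) (p p' q q' : I -> X) :
  path_homotopic x y p p' -> path_homotopic y z q q' ->
  path_homotopic x z (path_cat p q) (path_cat p' q').
Proof.
move=> [H [cH H0 H1 Hx Hy]] [K [cK K0 K1 Kx Ky]].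
exists (fun st => if uval st.1 <= 2^-1 then H (clamp (2 * uval st.1), st.2)
                  else K (clamp (2 * uval st.1 - 1), st.2)).
split=> /= [|s|s|t|t].
- apply: continuous_if.
  + by solve_continuous.
  + by apply: comp_continuous => //; solve_continuous.
  + by apply: comp_continuous => //; solve_continuous.
  + by move=> [s t] /= ->; rewrite divff // subrr Hy Kx.
- by rewrite H0 K0.
- by rewrite H1 K1.
- by rewrite uval_zero invr_ge0 ler0n mulr0 Hx.
- rewrite uval_one ifF; last by apply/negbTE; rewrite -ltNge; lra.
  by rewrite mulr1 (_ : 2 - 1 = 1) ?Ky //; lra.
Qed.

Lemma path_homotopic_inv (x y : X) (p q : I -> X) :
  path_homotopic x y p q -> path_homotopic y x (path_inv p) (path_inv q).
Proof.
move=> [H [cH H0 H1 Hx Hy]].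
exists (fun st => H (clamp (1 - uval st.1), st.2)); split=> /= [|s|s|t|t].
- by apply: comp_continuous => //; solve_continuous.
- by rewrite H0.
- by rewrite H1.
- by rewrite uval_zero subr0 Hy.
- by rewrite uval_one subrr Hx.
Qed.

(** Both sides of each group law are reparametrizations of one path. *)
Lemma path_homotopic_subst (x y : X) (f : I -> X) (phi psi : I -> R)
    (p q : {path I from x to y}) :
  continuous f -> continuous phi -> continuous psi ->
  phi zero = psi zero -> phi one = psi one ->
  p =1 f \o clamp \o phi -> q =1 f \o clamp \o psi ->
  path_homotopic x y p q.
Proof.
move=> cf cphi cpsi e0 e1 pE qE.
have := path_homotopic_reparam cf cphi cpsi e0 e1.
rewrite -[f (clamp (phi zero))]/((f \o clamp \o phi) zero) -pE.
rewrite -[f (clamp (phi one))]/((f \o clamp \o phi) one) -pE.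
by rewrite path_zero path_one -(funext pE) -(funext qE).
Qed.

End path_homotopy.

Section fundamental_group.
Context (R : realType) {X : topologicalType} (x : X).
Local Notation I := (unit_itv R).
Local Notation loop := {path I from x to x}.

Definition loop_homotopic : rel loop :=
  fun p q => `[< path_homotopic x x p q >].

Lemma loop_homotopic_refl : reflexive loop_homotopic.
Proof. by move=> p; apply/asboolP; exact: path_homotopic_refl. Qed.

Lemma loop_homotopic_sym : symmetric loop_homotopic.
Proof. by move=> p q; apply/asboolP/asboolP; exact: path_homotopic_sym. Qed.

Lemma loop_homotopic_trans : transitive loop_homotopic.
Proof.
move=> q p r /asboolP pq /asboolP qr; apply/asboolP.
exact: path_homotopic_trans pq qr.
Qed.

Canonical loop_homotopic_equiv := EquivRel loop_homotopic
  loop_homotopic_refl loop_homotopic_sym loop_homotopic_trans.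

Definition pi1 : Type := {eq_quot loop_homotopic}.

HB.instance Definition _ := Choice.on pi1.
HB.instance Definition _ := EqQuotient.on pi1.

Lemma pi1_eqP (p q : loop) :
  path_homotopic x x p q <-> \pi_pi1 p = \pi_pi1 q.
Proof.
by split=> [pq|/eqquotP/asboolP//]; apply/eqquotP/asboolP.
Qed.

Lemma pi1_reprP (p : loop) : path_homotopic x x (repr (\pi_pi1 p)) p.
Proof. by apply/pi1_eqP; rewrite reprK. Qed.

Lemma pi1_ind (P : pi1 -> Prop) : (forall p, P (\pi_pi1 p)) -> forall a, P a.
Proof. by move=> h a; rewrite -[a]reprK. Qed.

Definition pi1_one : pi1 := \pi_pi1 (cst x : loop).

Definition pi1_mul (a b : pi1) : pi1 :=
  \pi_pi1 (path_cat (repr a) (repr b) : loop).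

Definition pi1_inv (a : pi1) : pi1 := \pi_pi1 (path_inv (repr a) : loop).

Lemma pi1_mulE (p q : loop) :
  pi1_mul (\pi_pi1 p) (\pi_pi1 q) = \pi_pi1 (path_cat p q : loop).
Proof. by apply/pi1_eqP/path_homotopic_cat; exact: pi1_reprP. Qed.

Lemma pi1_invE (p : loop) :
  pi1_inv (\pi_pi1 p) = \pi_pi1 (path_inv p : loop).
Proof. by apply/pi1_eqP/path_homotopic_inv; exact: pi1_reprP. Qed.

End fundamental_group.

Section group_laws.
Context {R : realType} {X : topologicalType} {x : X}.
Local Notation I := (unit_itv R).
Local Notation loop := {path I from x to x}.

Lemma path_homotopic_catA (p q r : loop) :
  path_homotopic x x (path_cat p (path_cat q r)) (path_cat (path_cat p q) r).
Proof.
apply: (@path_homotopic_subst _ _ _ _ (path_cat p (path_cat q r)) uval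
  (fun t => Num.min (2 * uval t)
     (Num.min (uval t + 4^-1) (2^-1 * uval t + 2^-1)))).
- exact: cts_fun.
- by solve_continuous.
- by solve_continuous.
- by rewrite uval_zero; interval_cases; lra.
- by rewrite uval_one; interval_cases; lra.
- by move=> t /=; rewrite uvalK.
move=> t /=; have := uval_ge0 t; have := uval_le1 t.
rewrite {1}/path_cat; move: (uval t) => u u1 u0.
have leT (a b : R) : a <= b -> (a <= b) = true by [].
have leF (a b : R) : b < a -> (a <= b) = false by move/lt_geF.
have [u4|u4] := lerP u 4^-1.
  rewrite (_ : Num.min (2 * u) _ = 2 * u); last by interval_cases; lra.
  rewrite leT; last lra.
  rewrite (path_cat_clamp p q); [|lra|lra].
  rewrite (path_cat_clamp p (path_cat q r)); [|lra|lra].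
  by rewrite leT; last lra.
have [u2|u2] := lerP u 2^-1.
  rewrite (_ : Num.min (2 * u) _ = u + 4^-1); last by interval_cases; lra.
  rewrite (path_cat_clamp p q); [|lra|lra].
  rewrite (path_cat_clamp p (path_cat q r)); [|lra|lra].
  rewrite leF; last lra.
  rewrite leF; last lra.
  rewrite (path_cat_clamp q r); [|lra|lra].
  by rewrite leT; [congr (q (clamp _)); lra | lra].
rewrite (_ : Num.min (2 * u) _ = 2^-1 * u + 2^-1); last by interval_cases; lra.
rewrite (path_cat_clamp p (path_cat q r)); [|lra|lra].
rewrite leF; last lra.
rewrite (path_cat_clamp q r); [|lra|lra].
rewrite leF; last lra.
by congr (r (clamp _)); lra.
Qed.

Lemma path_homotopic_cst_cat (p : loop) :
  path_homotopic x x (path_cat (cst x : loop) p) p.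
Proof.
apply: (@path_homotopic_subst _ _ _ _ p
  (fun t => Num.max 0 (2 * uval t - 1)) uval).
- exact: cts_fun.
- by solve_continuous.
- by solve_continuous.
- by rewrite uval_zero; interval_cases; lra.
- by rewrite uval_one; interval_cases; lra.
- move=> t /=; rewrite /path_cat; case: (lerP (uval t)) => ht.
    by rewrite (max_idPl _) -/zero ?path_zero //; lra.
  by rewrite (max_idPr _) //; lra.
- by move=> t /=; rewrite uvalK.
Qed.

Lemma path_homotopic_cat_cst (p : loop) :
  path_homotopic x x (path_cat p (cst x : loop)) p.
Proof.
apply: (@path_homotopic_subst _ _ _ _ p
  (fun t => Num.min 1 (2 * uval t)) uval).
- exact: cts_fun.
- by solve_continuous.
- by solve_continuous.
- by rewrite uval_zero; interval_cases; lra.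
- by rewrite uval_one; interval_cases; lra.
- move=> t /=; rewrite /path_cat; case: (lerP (uval t)) => ht.
    by rewrite (min_idPr _) //; lra.
  by rewrite (min_idPl _) -/one ?path_one //; lra.
- by move=> t /=; rewrite uvalK.
Qed.

Lemma path_homotopic_catV (p : loop) :
  path_homotopic x x (path_cat p (path_inv p)) (cst x : loop).
Proof.
apply: (@path_homotopic_subst _ _ _ _ p
  (fun t => Num.min (2 * uval t) (2 - 2 * uval t)) (fun=> 0)).
- exact: cts_fun.
- by solve_continuous.
- by solve_continuous.
- by rewrite uval_zero; interval_cases; lra.
- by rewrite uval_one; interval_cases; lra.
- move=> t /=; rewrite /path_cat /path_inv !uval_clamp.
  have := uval_ge0 t; have := uval_le1 t; move: (uval t) => u u1 u0.
  by interval_cases; congr (_ (clamp _)); lra.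
- by move=> t /=; rewrite -/zero path_zero.
Qed.

Lemma path_homotopic_Vcat (p : loop) :
  path_homotopic x x (path_cat (path_inv p) p) (cst x : loop).
Proof.
apply: (@path_homotopic_subst _ _ _ _ p
  (fun t => Num.max (1 - 2 * uval t) (2 * uval t - 1)) (fun=> 1)).
- exact: cts_fun.
- by solve_continuous.
- by solve_continuous.
- by rewrite uval_zero; interval_cases; lra.
- by rewrite uval_one; interval_cases; lra.
- move=> t /=; rewrite /path_cat /path_inv !uval_clamp.
  have := uval_ge0 t; have := uval_le1 t; move: (uval t) => u u1 u0.
  by interval_cases; congr (_ (clamp _)); lra.
- by move=> t /=; rewrite -/one path_one.
Qed.

Local Notation G := (@pi1 R X x).

Lemma pi1_mulA : associative (@pi1_mul R X x).
Proof.
elim/(@pi1_ind R) => p; elim/(@pi1_ind R) => q; elim/(@pi1_ind R) => r.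
by rewrite !pi1_mulE; apply/pi1_eqP/path_homotopic_catA.
Qed.

Lemma pi1_mul1g : left_id (@pi1_one R X x) (@pi1_mul R X x).
Proof.
elim/(@pi1_ind R) => p; rewrite /pi1_one pi1_mulE.
exact/pi1_eqP/path_homotopic_cst_cat.
Qed.

Lemma pi1_mulg1 : right_id (@pi1_one R X x) (@pi1_mul R X x).
Proof.
elim/(@pi1_ind R) => p; rewrite /pi1_one pi1_mulE.
exact/pi1_eqP/path_homotopic_cat_cst.
Qed.

Lemma pi1_mulVg :
  left_inverse (@pi1_one R X x) (@pi1_inv R X x) (@pi1_mul R X x).
Proof.
elim/(@pi1_ind R) => p; rewrite pi1_invE pi1_mulE.
exact/pi1_eqP/path_homotopic_Vcat.
Qed.

Lemma pi1_mulgV :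
  right_inverse (@pi1_one R X x) (@pi1_inv R X x) (@pi1_mul R X x).
Proof.
elim/(@pi1_ind R) => p; rewrite pi1_invE pi1_mulE.
exact/pi1_eqP/path_homotopic_catV.
Qed.

HB.instance Definition _ := isGroup.Build G
  pi1_mulA pi1_mul1g pi1_mulg1 pi1_mulVg pi1_mulgV.

Lemma pi1_oneE : (1 : G)%g = \pi_G (cst x : loop).
Proof. by []. Qed.

Lemma pi1_mulgE (p q : loop) :
  (\pi_G p * \pi_G q)%g = \pi_G (path_cat p q : loop).
Proof. exact: pi1_mulE. Qed.

Lemma pi1_invgE (p : loop) : (\pi_G p)^-1%g = \pi_G (path_inv p : loop).
Proof. exact: pi1_invE. Qed.

End group_laws.

Section induced_map.
Context (R : realType) {X Y : topologicalType}.
Variables (f : continuousType X Y) (x : X).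
Local Notation loop := {path (unit_itv R) from x to x}.

Definition pi1_map (a : pi1 R x) : pi1 R (f x) :=
  \pi_(pi1 R (f x)) (f \o (repr a : loop) : {path _ from f x to f x}).

Lemma pi1_mapE (p : loop) :
  pi1_map (\pi_(pi1 R x) p) =
  \pi_(pi1 R (f x)) (f \o p : {path _ from f x to f x}).
Proof.
apply/pi1_eqP; have [H [cH H0 H1 Hx Hy]] := pi1_reprP p.
exists (f \o H); split=> /= [|s|s|t|t]; last 4 first.
- by rewrite H0.
- by rewrite H1.
- by rewrite Hx.
- by rewrite Hy.
by apply: comp_continuous => //; exact: cts_fun.
Qed.

Lemma pi1_map_monoid_morphism : monoid.monoid_morphism pi1_map.
Proof.
split.
  by rewrite pi1_oneE pi1_mapE; congr \pi; apply/path_eqP.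
elim/pi1_ind => p; elim/pi1_ind => q.
rewrite pi1_mulgE !pi1_mapE pi1_mulgE; congr \pi; apply/path_eqP => t /=.
by rewrite /path_cat; case: ifP.
Qed.

HB.instance Definition _ :=
  isUMagmaMorphism.Build (pi1 R x) (pi1 R (f x)) pi1_map
    pi1_map_monoid_morphism.

End induced_map.

Section pi1_prod.
Context (R : realType) {X : topologicalType} {n : nat}.
Variable x : {ptws 'I_n -> X}.

Definition pi1_prod : Type := forall i : 'I_n, pi1 R (x i).

HB.instance Definition _ := gen_eqMixin pi1_prod.
HB.instance Definition _ := gen_choiceMixin pi1_prod.

Definition pi1_prod_one : pi1_prod := fun=> 1%g.
Definition pi1_prod_inv (a : pi1_prod) : pi1_prod := fun i => (a i)^-1%g.
Definition pi1_prod_mul (a b : pi1_prod) : pi1_prod := fun i => (a i * b i)%g.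

Lemma pi1_prod_mulA : associative pi1_prod_mul.
Proof.
by move=> a b c; apply: functional_extensionality_dep => i; exact: mulgA.
Qed.

Lemma pi1_prod_mul1g : left_id pi1_prod_one pi1_prod_mul.
Proof. by move=> a; apply: functional_extensionality_dep => i; exact: mul1g. Qed.

Lemma pi1_prod_mulg1 : right_id pi1_prod_one pi1_prod_mul.
Proof. by move=> a; apply: functional_extensionality_dep => i; exact: mulg1. Qed.

Lemma pi1_prod_mulVg : left_inverse pi1_prod_one pi1_prod_inv pi1_prod_mul.
Proof. by move=> a; apply: functional_extensionality_dep => i; exact: mulVg. Qed.

Lemma pi1_prod_mulgV : right_inverse pi1_prod_one pi1_prod_inv pi1_prod_mul.
Proof. by move=> a; apply: functional_extensionality_dep => i; exact: mulgV. Qed.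

HB.instance Definition _ := isGroup.Build pi1_prod pi1_prod_mulA
  pi1_prod_mul1g pi1_prod_mulg1 pi1_prod_mulVg pi1_prod_mulgV.

End pi1_prod.

Section configuration_space.
Context (R : realType) {X : topologicalType} {n : nat}.

Definition config_space : set {ptws 'I_n -> X} :=
  [set x | forall i j : 'I_n, i != j -> x i <> x j].

Definition config_incl (x : config_space) : {ptws 'I_n -> X} := set_val x.

Lemma config_incl_continuous : continuous config_incl.
Proof. exact: initial_continuous. Qed.

HB.instance Definition _ :=
  isContinuous.Build _ _ config_incl config_incl_continuous.

Definition config_coord (i : 'I_n) (x : {ptws 'I_n -> X}) : X := x i.

Lemma config_coord_continuous i : continuous (config_coord i).
Proof. exact: (@proj_continuous _ (fun=> X) i). Qed.

HB.instance Definition _ i :=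
  isContinuous.Build _ _ (config_coord i) (@config_coord_continuous i).

Variable x0 : config_space.

Definition pure_braid_group : Type := pi1 R x0.

HB.instance Definition _ := Group.on pure_braid_group.

(** The map induced by [config_incl], followed by the isomorphism from the
    fundamental group of a product to the product of the fundamental groups. *)
Definition strand_map (b : pure_braid_group) : pi1_prod R (config_incl x0) :=
  fun i => pi1_map (config_coord i) (pi1_map config_incl b).

Lemma strand_map_monoid_morphism : monoid.monoid_morphism strand_map.
Proof.
split=> [|a b]; apply: functional_extensionality_dep => i.
  by rewrite /strand_map !gmulf1.
by rewrite /strand_map !gmulfM.
Qed.

HB.instance Definition _ :=
  isUMagmaMorphism.Build pure_braid_group (pi1_prod R (config_incl x0))
    strand_map strand_map_monoid_morphism.

End configuration_space.

Arguments config_space X n : clear implicits.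
Arguments pure_braid_group R {X n} x0.
Arguments strand_map R {X n} x0 b i.

(* Main.v *)
(** If two strands on the circle never meet, their quotient avoids [1] and has
    a well-defined argument; so when one strand is null-homotopic the other
    one is too, and a generator cannot be paired with a trivial class.

    Conversely, let [w] be a vertex with three neighbours [u1], [u2], [u3].
    Every configuration can be moved into the open edge [w u1], where it is
    enough to realize a loop of a single point while the others stay in place.
    Such a loop is homotopic to an edge path. Edges other than [w u1] contain
    none of the other points. Along [w u1] the points have to pass one another,
    which is possible inside the tripod at [w]; since the closed star of [w] is
    contractible, the homotopy classes of the strands are then automatically
    correct. Without such a vertex, the complex is a simplex, an arc or a
    circle, and the first two are contractible. *)
Require Import Defs.
From HB Require Import structures.
From mathcomp Require Import all_boot all_order all_algebra generic_quotient.
From mathcomp Require Import lra ring zify.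
From mathcomp Require Import all_classical all_reals all_analysis.
From mathcomp Require Import homotopy.
Import Order.TTheory GRing.Theory Num.Theory.
Import numFieldNormedType.Exports.

Set Implicit Arguments.
Unset Strict Implicit.
Unset Printing Implicit Defensive.

Local Open Scope classical_set_scope.
Local Open Scope ring_scope.
Local Open Scope quotient_scope.

(** * Paths and deformations *)

(** Surjectivity is reduced to [full]: every loop of tuples at a configuration is homotopic, in the
    product, to a loop of configurations. This property is invariant under paths of configurations,
    which is what allows the basepoint to be gathered on one edge. Which point ends up where is
    immaterial there, so gathering exchanges points instead of making them pass one another. Passing
    is needed only when a loop is realized, and then the tripod is at hand.

    Conjugation by a path is expressed through subpaths with arbitrary, possibly decreasing,
    parameters: a path is the middle piece of a longer one, and it is replaced by going back to the
    start of the longer one, traversing it completely and returning from its end. No calculation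
    with inverse paths is then required.

    On the circle, winding number zero is expressed by the existence of a closed lift. Its homotopy
    invariance comes from the avoidance argument itself: nearby loops are never antipodal, so each
    avoids the opposite of the other, and the opposite loop is lifted by adding [pi]. *)

Lemma continuous_ptws (T Y : topologicalType) (J : choiceType)
    (f : T -> {ptws J -> Y}) :
  (forall j, continuous (fun t => f t j)) -> continuous f.
Proof.
move=> cf x; apply/cvg_sup => j.
apply: (@continuous_comp_initial _ _ _ (fun g : J -> Y => g j)) => t.
exact: cf.
Qed.

Lemma ptws_proj_continuous (T Y : topologicalType) (J : choiceType)
    (f : T -> {ptws J -> Y}) j : continuous f -> continuous (fun t => f t j).
Proof.
move=> cf; apply: (comp_continuous (g := fun g : {ptws J -> Y} => g j)) cf.
exact: (@proj_continuous J (fun=> Y) j).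
Qed.

Lemma continuous_set_type (T Y : topologicalType) (A : set Y) (f : T -> A) :
  continuous (fun t => set_val (f t)) -> continuous f.
Proof. exact: (@continuous_comp_initial _ _ _ set_val). Qed.

Lemma set_val_continuous (Y : topologicalType) (A : set Y) :
  continuous (set_val : A -> Y).
Proof. exact: initial_continuous. Qed.

Lemma sum_continuous (R : realType) (T : topologicalType) (J : Type)
    (r : seq J) (P : pred J) (f : J -> T -> R) :
  (forall j, continuous (f j)) ->
  continuous (fun t => \sum_(j <- r | P j) f j t).
Proof.
move=> cf; elim: r => [|j r IH].
  by under eq_fun do rewrite big_nil; exact: cstr_continuous.
under eq_fun do rewrite big_cons; case: (P j) => //.
exact: addr_continuous.
Qed.

Section paths.
Context {R : realType} {Z : topologicalType}.
Local Notation I := (unit_itv R).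
Implicit Types (p q f : I -> Z) (F : set Z) (a b c : R).

Lemma clamp_zero : clamp 0 = zero :> I. Proof. by []. Qed.

Lemma clamp_one : clamp 1 = one :> I. Proof. by []. Qed.

Lemma clamp_le0 a : a <= 0 -> clamp a = zero :> I.
Proof.
move=> a0; apply: uval_inj; rewrite uval_zero uval_clamp.
by rewrite (min_idPr _) ?(max_idPl _)//; lra.
Qed.

Lemma clamp_ge1 a : 1 <= a -> clamp a = one :> I.
Proof.
move=> a0; apply: uval_inj; rewrite uval_one uval_clamp.
by rewrite (min_idPl _) ?(max_idPr _)//; lra.
Qed.

Lemma path_cat_cts p q : continuous p -> continuous q -> p one = q zero ->
  continuous (path_cat p q).
Proof.
move=> cp cq pq; apply: continuous_if.
- by solve_continuous.
- by apply: comp_continuous => //; solve_continuous.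
- by apply: comp_continuous => //; solve_continuous.
- by move=> t ->; rewrite divff // subrr clamp_zero clamp_one.
Qed.

(** The parameters are not ordered: for [b < a] the path runs backwards. *)
Definition subpath f a b : I -> Z := fun t => f (clamp (a + (b - a) * uval t)).

Lemma subpath_zero f a b : subpath f a b zero = f (clamp a).
Proof. by rewrite /subpath uval_zero mulr0 addr0. Qed.

Lemma subpath_one f a b : subpath f a b one = f (clamp b).
Proof. by rewrite /subpath uval_one mulr1 addrC subrK. Qed.

Lemma subpath01 f : subpath f 0 1 = f.
Proof. by apply/funext => t; rewrite /subpath subr0 mul1r add0r uvalK. Qed.

Lemma subpath_cts f a b : continuous f -> continuous (subpath f a b).
Proof. by move=> cf; apply: comp_continuous => //; solve_continuous. Qed.

Lemma homotopic_refl p : continuous p -> path_homotopic (p zero) (p one) p p.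
Proof.
move=> cp; exists (p \o fst); split=> //=.
by apply: comp_continuous; solve_continuous.
Qed.

(** Both sides are reparametrizations of [f] with the same ends. As [b] need not lie between [a] and
    [c], detours can be inserted. *)
Lemma subpath_cat f a b c : continuous f ->
  0 <= a <= 1 -> 0 <= b <= 1 -> 0 <= c <= 1 ->
  path_homotopic (f (clamp a)) (f (clamp c)) (subpath f a c)
    (path_cat (subpath f a b) (subpath f b c)).
Proof.
move=> cf a01 b01 c01.
pose phi (t : I) := a + (c - a) * uval t.
(* The piecewise linear function from [a] to [b] on the first half and from [b] to [c] on the
   second. *)
pose psi (t : I) := a + (b - a) * Num.min 1 (2 * uval t) +
                    (c - b) * Num.max 0 (2 * uval t - 1).
have := @path_homotopic_reparam R Z f phi psi cf.
rewrite /phi /psi !uval_zero !uval_one !mulr0 !mulr1 !addr0.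
have -> : a + (c - a) = c by lra.
rewrite (_ : Num.min 1 0 = 0); last by interval_cases; lra.
rewrite (_ : Num.max 0 (0 - 1) = 0); last by interval_cases; lra.
rewrite (_ : Num.min 1 2 = 1); last by interval_cases; lra.
rewrite (_ : Num.max 0 (2 - 1) = 1); last by interval_cases; lra.
rewrite !mulr0 !mulr1 !addr0.
have -> : a + (b - a) + (c - b) = c by lra.
have cphi : continuous phi by rewrite /phi; solve_continuous.
have cpsi : continuous psi by rewrite /psi; solve_continuous.
move=> /(_ cphi cpsi erefl erefl).
congr (path_homotopic _ _ _ _).
apply/funext => t /=; rewrite /path_cat /subpath.
have := uval_ge0 t; have := uval_le1 t => t1 t0.
have [ht|ht] := lerP (uval t) 2^-1.
  rewrite (min_idPr _); last lra.
  rewrite (max_idPl _); last lra.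
  by rewrite uval_clamp_id ?mulr0 ?addr0//; lra.
rewrite (min_idPl _); last lra.
rewrite (max_idPr _); last lra.
rewrite uval_clamp_id; [|lra|lra].
by congr (f (clamp _)); lra.
Qed.

Lemma homotopic_ends x y p q : path_homotopic x y p q ->
  [/\ p zero = x, p one = y, q zero = x & q one = y].
Proof. by move=> [H [_ H0 H1 Hx Hy]]; rewrite -!H0 -!H1 !Hx !Hy. Qed.

(** The homotopy may leave [F]; only the path at which it ends has to stay inside. *)
Definition deformable F p := exists q, [/\ continuous q, forall t, F (q t)
  & path_homotopic (p zero) (p one) p q].

Lemma deformable_id F p :
  continuous p -> (forall t, F (p t)) -> deformable F p.
Proof. by move=> cp Fp; exists p; split=> //; exact: homotopic_refl. Qed.

Lemma deformable_homotopic F p q :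
  path_homotopic (p zero) (p one) p q -> deformable F q -> deformable F p.
Proof.
move=> pq [r [cr Fr qr]]; exists r; split=> //.
have [_ _ q0 q1] := homotopic_ends pq; rewrite q0 q1 in qr.
exact: path_homotopic_trans pq qr.
Qed.

Lemma path_cat_zeroE p q : path_cat p q zero = p zero.
Proof. by rewrite /path_cat uval_zero invr_ge0 ler0n mulr0 clamp_zero. Qed.

Lemma path_cat_oneE p q : path_cat p q one = q one.
Proof.
rewrite /path_cat uval_one ifF; last by apply/negbTE; rewrite -ltNge; lra.
by rewrite mulr1 (_ : 2 - 1 = 1) //; lra.
Qed.

Lemma path_cat_in F p q t :
  (forall s, F (p s)) -> (forall s, F (q s)) -> F (path_cat p q t).
Proof. by rewrite /path_cat; case: ifP. Qed.

Lemma deformable_cat F p q : p one = q zero ->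
  deformable F p -> deformable F q -> deformable F (path_cat p q).
Proof.
move=> pq [p' [cp' Fp' pp']] [q' [cq' Fq' qq']].
exists (path_cat p' q'); rewrite path_cat_zeroE path_cat_oneE.
have [_ _ _ p'1] := homotopic_ends pp'; have [_ _ q'0 _] := homotopic_ends qq'.
split.
- by apply: path_cat_cts => //; rewrite p'1 q'0.
- by move=> t; exact: path_cat_in.
- by apply: path_homotopic_cat pp' _; rewrite pq.
Qed.

Lemma deformable_subpath_trans F f a b c : continuous f ->
  0 <= a <= 1 -> 0 <= b <= 1 -> 0 <= c <= 1 ->
  deformable F (subpath f a b) -> deformable F (subpath f b c) ->
  deformable F (subpath f a c).
Proof.
move=> cf a01 b01 c01 dab dbc.
apply: (deformable_homotopic (q := path_cat (subpath f a b) (subpath f b c))).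
  by rewrite subpath_zero subpath_one; exact: subpath_cat.
by apply: deformable_cat => //; rewrite subpath_zero subpath_one.
Qed.

Lemma deformable_subdivide F f (N : nat) : continuous f ->
  (forall k, (k < N.+1)%N ->
    deformable F (subpath f (k%:R / N.+1%:R) (k.+1%:R / N.+1%:R))) ->
  deformable F f.
Proof.
move=> cf df.
have in01 k : (k <= N.+1)%N -> 0 <= (k%:R / N.+1%:R : R) <= 1.
  by move=> kN; rewrite divr_ge0//= ler_pdivrMr ?ltr0n// mul1r ler_nat.
suff H k : (k < N.+1)%N -> deformable F (subpath f 0 (k.+1%:R / N.+1%:R)).
  by have := H _ (ltnSn N); rewrite divff ?pnatr_eq0// subpath01.
elim: k => [|k IH] kN; first by have := df _ kN; rewrite mul0r.
apply: (@deformable_subpath_trans _ _ _ (k.+1%:R / N.+1%:R)) => //.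
- by rewrite lexx ler01.
- exact/in01/ltnW.
- exact: in01.
- exact/IH/ltnW.
- exact: df.
Qed.

(** Both paths are homotopic to the one running along the left, top and right
    sides of the square. *)
Lemma homotopic_contract p q w (G G' : I * I -> Z) :
  continuous G -> continuous G' ->
  (forall s, G (s, zero) = p s) -> (forall s, G' (s, zero) = q s) ->
  (forall s, G (s, one) = w) -> (forall s, G' (s, one) = w) ->
  (forall t, G (zero, t) = G' (zero, t)) ->
  (forall t, G (one, t) = G' (one, t)) ->
  path_homotopic (p zero) (p one) p q.
Proof.
move=> cG cG' Gp Gq Gw Gw' G0 G1.
pose L (s : I) : I * I :=
  (clamp (3 * uval s - 1), clamp (Num.min (3 * uval s) (3 - 3 * uval s))).
have key (r : I -> Z) (K : I * I -> Z) : continuous K ->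
    (forall s, K (s, zero) = r s) ->
    path_homotopic (r zero) (r one) r (K \o L).
  move=> cK Kr.
  (* The straight-line homotopy in the square from the bottom side to [L], which has the same two
     corners as ends. *)
  exists (fun st => K (clamp (uval st.1 * (1 - uval st.2) +
                              uval (clamp (3 * uval st.1 - 1)) * uval st.2),
     clamp (uval st.2 * Num.min (3 * uval st.1) (3 - 3 * uval st.1)))).
  split=> [|s|s|t|t] /=.
  - by apply: comp_continuous => //; solve_continuous.
  - by rewrite uval_zero subr0 mulr1 mulr0 mul0r addr0 uvalK clamp_zero.
  - by rewrite uval_one subrr mulr0 add0r mulr1 mul1r uvalK.
  - rewrite uval_zero (clamp_le0 (a := 3 * 0 - 1)); last lra.
    rewrite uval_zero !mul0r addr0 (_ : Num.min _ _ = 0) ?mulr0//.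
    by interval_cases; lra.
  - rewrite uval_one (clamp_ge1 (a := 3 * 1 - 1)); last lra.
    rewrite uval_one !mul1r subrK (_ : Num.min _ _ = 0) ?mulr0//.
    by interval_cases; lra.
have GE : G \o L = G' \o L.
  apply/funext => s; rewrite /L /=.
  have [s1|s1] := lerP (uval s) 3^-1.
    by rewrite (clamp_le0 (a := _ - 1)) ?G0//; lra.
  have [s2|s2] := lerP (2/3) (uval s).
    by rewrite (clamp_ge1 (a := _ - 1)) ?G1//; lra.
  by rewrite (clamp_ge1 (a := Num.min _ _)) ?Gw ?Gw'//; interval_cases; lra.
apply: path_homotopic_trans (key _ _ cG Gp) _.
rewrite GE -Gp -Gp G0 G1 !Gq; apply: path_homotopic_sym; exact: key.
Qed.

End paths.

(** The identity on [f], with the proofs as arguments so that a path structure can be attached to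
    it. *)
Definition path_fun (R : realType) (Z : topologicalType) (x y : Z)
    (f : unit_itv R -> Z) & continuous f & f zero = x & f one = y := f.

HB.instance Definition _ (R : realType) (Z : topologicalType) (x y : Z)
    (f : unit_itv R -> Z) (cf : continuous f) (f0 : f zero = x)
    (f1 : f one = y) :=
  isContinuous.Build _ _ (path_fun cf f0 f1) cf.

HB.instance Definition _ (R : realType) (Z : topologicalType) (x y : Z)
    (f : unit_itv R -> Z) (cf : continuous f) (f0 : f zero = x)
    (f1 : f one = y) :=
  isPath.Build _ _ x y (path_fun cf f0 f1) f0 f1.

(** * Configurations *)

Section configurations.
Context {R : realType} {X : topologicalType} {n : nat}.
Local Notation I := (unit_itv R).
Local Notation Z := {ptws 'I_n -> X}.
Local Notation F := (@config_space X n).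
Implicit Types (a b c : Z) (T : set X).

Definition upd (S : Type) (c : 'I_n -> S) (k : 'I_n) (y : S) : 'I_n -> S :=
  fun j => if j == k then y else c j.

Lemma updE S (c : 'I_n -> S) k y : upd c k y k = y.
Proof. by rewrite /upd eqxx. Qed.

Lemma updN S (c : 'I_n -> S) k y j : j != k -> upd c k y j = c j.
Proof. by rewrite /upd => /negbTE ->. Qed.

Lemma upd_id S (c : 'I_n -> S) k : upd c k (c k) = c.
Proof. by apply/funext => j; rewrite /upd; case: eqP => // ->. Qed.

Lemma upd_cts (T : topologicalType) c k (f : T -> X) :
  continuous f -> continuous (fun t => upd c k (f t) : Z).
Proof.
move=> cf; apply: continuous_ptws => j; rewrite /upd; case: eqP => // _ t.
exact: cvg_cst.
Qed.

Lemma upd_config c k y :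
  F c -> (forall j, j != k -> c j <> y) -> F (upd c k y : Z).
Proof.
move=> Fc cy i j; rewrite /upd.
move=> ij; case: (eqVneq i k) ij => [->|ik]; case: (eqVneq j k) => // jk.
- by move=> _ /esym; exact: cy.
- by move=> _; exact: cy.
- exact: Fc.
Qed.

(** [T] is either the whole space or a closed star, where confinement controls the homotopy classes
    of the strands. *)
Definition conn T a b := exists f : I -> Z,
  [/\ continuous f, f zero = a, f one = b, forall t, F (f t)
    & forall t j, T (f t j)].

Lemma conn_refl T a : F a -> (forall j, T (a j)) -> conn T a a.
Proof. by move=> Fa Ta; exists (fun=> a); split=> //; exact: cstr_continuous. Qed.

Lemma conn_sym T a b : conn T a b -> conn T b a.
Proof.
move=> [f [cf f0 f1 Ff Tf]]; exists (path_inv f); split=> //.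
- by apply: comp_continuous => //; solve_continuous.
- by rewrite /path_inv uval_zero subr0 clamp_one.
- by rewrite /path_inv uval_one subrr clamp_zero.
- by move=> t; exact: Ff.
- by move=> t j; exact: Tf.
Qed.

Lemma conn_trans T b a c : conn T a b -> conn T b c -> conn T a c.
Proof.
move=> [f [cf f0 f1 Ff Tf]] [g [cg g0 g1 Fg Tg]].
exists (path_cat f g); split=> //.
- by apply: path_cat_cts => //; rewrite f1 g0.
- by rewrite path_cat_zeroE.
- by rewrite path_cat_oneE.
- by move=> t; exact: path_cat_in.
- by move=> t j; rewrite /path_cat; case: ifP.
Qed.

Lemma conn_config T a b : conn T a b -> F b.
Proof. by move=> [f [_ _ <- Ff _]]. Qed.

(** A loop in the product is a tuple of loops, so this is surjectivity of the strand map at [c] in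
    terms of loops instead of classes. *)
Definition full c := forall p : I -> Z,
  continuous p -> p zero = c -> p one = c -> deformable F p.

(** Change of basepoint: conjugating a loop by a path of configurations adds only pieces that
    already lie in [F]. *)
Lemma full_conn a b : conn setT a b -> full b -> full a.
Proof.
move=> [f [cf f0 f1 Ff _]] fullb p cp p0 p1.
pose q := path_cat (path_inv f) (path_cat p f).
have cif : continuous (path_inv f).
  by apply: comp_continuous => //; solve_continuous.
have cpf : continuous (path_cat p f).
  by apply: path_cat_cts => //; rewrite p1 f0.
have if0 : path_inv f zero = b by rewrite /path_inv uval_zero subr0 clamp_one.
have if1 : path_inv f one = a by rewrite /path_inv uval_one subrr clamp_zero.
have cq : continuous q by apply: path_cat_cts => //; rewrite if1 path_cat_zeroE.
have q0 : q zero = b by rewrite /q path_cat_zeroE.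
have q1 : q one = b by rewrite /q !path_cat_oneE.
(* [path_cat] halves its intervals, so [p] occupies the parameters from 1/2 to 3/4 of [q]. *)
have -> : p = subpath q 2^-1 (3/4).
  apply/funext => t; have t0 := uval_ge0 t; have t1 := uval_le1 t.
  rewrite /subpath /q path_cat_clamp; [|lra|lra].
  case: ifP => [t2|_].
    have -> : t = zero by apply: uval_inj; rewrite uval_zero; lra.
    by rewrite p0 uval_zero mulr0 addr0 divff.
  rewrite path_cat_clamp; [|lra|lra].
  rewrite ifT; last lra.
  by rewrite -[in LHS](uvalK t); congr (p (clamp _)); lra.
have in01 (x : R) : 0 <= x -> x <= 1 -> 0 <= x <= 1 by move=> -> ->.
(* Go from 1/2 back to 0, through all of [q], and from 1 back to 3/4. The outer pieces follow [f];
   the middle one is a loop at [b]. *)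
apply: (@deformable_subpath_trans _ _ _ _ _ 1) => //; try by apply: in01; lra.
  apply: (@deformable_subpath_trans _ _ _ _ _ 0) => //;
    try by apply: in01; lra.
    apply: deformable_id; first exact: subpath_cts.
    move=> t; have t0 := uval_ge0 t; have t1 := uval_le1 t.
    rewrite /subpath /q path_cat_clamp; [|lra|lra].
    by rewrite ifT; [exact: Ff|lra].
  by rewrite subpath01; exact: fullb.
apply: deformable_id; first exact: subpath_cts.
move=> t; have t0 := uval_ge0 t; have t1 := uval_le1 t.
rewrite /subpath /q path_cat_clamp; [|lra|lra].
rewrite ifF; last by lra.
rewrite path_cat_clamp; [|lra|lra].
case: ifP => [t2|_]; last exact: Ff.
rewrite (_ : clamp _ = one) ?p1 -?f0 //.
by apply: clamp_ge1; lra.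
Qed.

(** A loop is homotopic to the one whose coordinates move one after another. *)
Lemma full_coordinatewise c :
  (forall k (g : I -> X), continuous g -> g zero = c k -> g one = c k ->
    deformable F (fun t => upd c k (g t) : Z)) ->
  full c.
Proof.
move=> dc p cp p0 p1.
have [n0|n_gt0] := posnP n.
  apply: deformable_id => // t i; have := ltn_ord i; by rewrite {2}n0.
(* Coordinate [j] makes its whole loop during the [j]-th of [n] equal intervals, counted from 0, and
   rests otherwise. *)
pose s (j : 'I_n) (t : I) : R := uval (clamp (n%:R * uval t - j%:R)).
pose q (t : I) : Z := fun j => p (clamp (s j t)) j.
have nR : 0 < n%:R :> R by rewrite ltr0n.
have cq : continuous q.
  apply: continuous_ptws => j.
  apply: (@ptws_proj_continuous _ _ _ (fun t => p (clamp (s j t)))).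
  by apply: (comp_continuous cp); rewrite /s; solve_continuous.
have s0 j : s j zero = 0.
  by rewrite /s uval_zero mulr0 clamp_le0 ?uval_zero// sub0r oppr_le0 ler0n.
have s1 j : s j one = 1.
  rewrite /s uval_one mulr1 clamp_ge1 ?uval_one//.
  by have := ltn_ord j; rewrite -(ler_nat R) -natr1; lra.
apply: (deformable_homotopic (q := q)).
  exists (fun st => (fun j => p (clamp (uval st.1 * (1 - uval st.2) +
                                   s j st.1 * uval st.2)) j) : Z).
  split=> [|t|t|t|t].
  - apply: continuous_ptws => j.
    apply: (@ptws_proj_continuous _ _ _ (fun st => p (clamp
      (uval st.1 * (1 - uval st.2) + s j st.1 * uval st.2)))).
    by apply: (comp_continuous cp); rewrite /s; solve_continuous.
  - apply/funext => j /=.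
    by rewrite uval_zero subr0 mulr0 mulr1 addr0 uvalK.
  - apply/funext => j /=.
    by rewrite uval_one subrr mulr0 mulr1 add0r.
  - by apply/funext => j /=; rewrite s0 uval_zero !mul0r addr0 clamp_zero.
  - apply/funext => j /=; rewrite s1 uval_one !mul1r subrK clamp_one //.
have [N nE] : exists N, n = N.+1 by case: (n) n_gt0 => // N; exists N.
apply: (@deformable_subdivide _ _ _ _ N) => // k kN; rewrite -nE in kN *.
pose k' := Ordinal kN.
(* Coordinates before [k] have completed their loops and those after it have not started; since
   these are loops, both sit at [c]. *)
rewrite (_ : subpath _ _ _ = fun t => upd c k' (p t k') : Z).
  apply: dc; first exact: ptws_proj_continuous.
  - by rewrite p0.
  - by rewrite p1.
apply/funext => t; apply/funext => j.
have t0 := uval_ge0 t; have t1 := uval_le1 t.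
have kn : k.+1%:R <= n%:R :> R by rewrite ler_nat.
have k0 : 0 <= k%:R :> R by rewrite ler0n.
have uE : uval (clamp (k%:R / n%:R + (k.+1%:R / n%:R - k%:R / n%:R) * uval t))
    = (k%:R + uval t) / n%:R.
  rewrite -natr1 in kn *; rewrite uval_clamp_id.
  - by field; exact: lt0r_neq0.
  - rewrite (_ : _ + _ = (k%:R + uval t) / n%:R); last by field; exact: lt0r_neq0.
    by rewrite divr_ge0 ?addr_ge0// ltW.
  - rewrite (_ : _ + _ = (k%:R + uval t) / n%:R); last by field; exact: lt0r_neq0.
    by rewrite ler_pdivrMr// mul1r; lra.
rewrite /subpath /q /s uE mulrCA divff ?lt0r_neq0// mulr1 uvalK.
rewrite /upd; case: eqP => [->|/eqP jk].
  rewrite (_ : k%:R + uval t - k'%:R = uval t) ?uvalK//.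
  by rewrite /= addrC addKr.
have {}jk : (j : nat) != k by [].
have [jk1|jk1] := ltnP j k.
  rewrite clamp_ge1 ?p1//.
  have : (j.+1)%:R <= k%:R :> R by rewrite ler_nat.
  by rewrite -natr1; lra.
have {}jk1 : (k < j)%N by rewrite ltn_neqAle eq_sym jk.
rewrite clamp_le0 ?p0//.
have : (k.+1)%:R <= j%:R :> R by rewrite ler_nat.
by rewrite -natr1; lra.
Qed.

(** Representatives of the given classes form one loop of tuples. Its deformation is a braid, and
    the coordinates of the homotopy identify the strands. *)
Lemma full_strand_map_surj (x0 : F) : full (config_incl x0) ->
  set_surj [set: pure_braid_group R x0] [set: pi1_prod R (config_incl x0)]
    (strand_map R x0).
Proof.
move=> fullx y _.
pose p (t : I) : Z := fun j => (repr (y j) : {path I from _ to _}) t.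
have cp : continuous p by apply: continuous_ptws => j; exact: cts_fun.
have p0 : p zero = config_incl x0 by apply/funext => j; rewrite /p path_zero.
have p1 : p one = config_incl x0 by apply/funext => j; rewrite /p path_one.
have [q [cq Fq pq]] := fullx p cp p0 p1.
have [_ _ q0 q1] := homotopic_ends pq.
pose g (t : I) : F := SigSub (mem_set (Fq t)).
have cg : continuous g by exact: continuous_set_type.
have g0 : g zero = x0 by apply: val_inj; rewrite /= q0 p0.
have g1 : g one = x0 by apply: val_inj; rewrite /= q1 p1.
pose G : {path I from x0 to x0} := path_fun cg g0 g1.
exists (\pi_(pi1 R x0) G) => //; apply: functional_extensionality_dep => j.
rewrite /strand_map !pi1_mapE -[y j]reprK; apply/pi1_eqP.
have [H [cH H0 H1 Hx Hy]] := path_homotopic_sym pq.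
exists (fun st => H st j); split=> /= [|s|s|t|t].
- exact: ptws_proj_continuous.
- by rewrite H0.
- by rewrite H1.
- by rewrite Hx p0.
- by rewrite Hy p1.
Qed.

End configurations.

Arguments conn R {X n} T a b.
Arguments full R {X n} c.

(** * Geometric realizations *)

Section realization.
Context {R : realType} {V : finType} (K : simplicial_complex V).
Local Notation I := (unit_itv R).
Local Notation X := (realization R K).
Implicit Types (x y : X) (g : V -> R) (u v w : V).

Definition bc x v : R := (set_val x : {ptws V -> R}) v.

Lemma bc_continuous v : continuous (bc ^~ v).
Proof.
apply: (@ptws_proj_continuous _ _ _ (set_val : X -> {ptws V -> R}) v).
exact: set_val_continuous.
Qed.

Lemma bc_inj x y : (forall v, bc x v = bc y v) -> x = y.
Proof. by move=> xy; apply: val_inj; apply/funext. Qed.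

Lemma bcP x : realization R K (bc x : {ptws V -> R}).
Proof. exact: set_valP. Qed.

Lemma bc_ge0 x v : 0 <= bc x v.
Proof. by have [] := bcP x. Qed.

Lemma bc_sum x : \sum_v bc x v = 1.
Proof. by have [] := bcP x. Qed.

Definition supp x := [set v | bc x v != 0]%SET.

Lemma supp_simplex x : supp x \in K.
Proof. by have [] := bcP x. Qed.

Lemma supp_vertex x v : v \in supp x -> [set v]%SET \in K.
Proof.
move=> vx; apply: (simplex_sub (supp_simplex x)); last by rewrite finset.sub1set.
by apply/set0Pn; exists v; rewrite inE.
Qed.

Lemma supp_neq0 x : exists v, v \in supp x.
Proof. exact/set0Pn/(simplex_neq0 (supp_simplex x)). Qed.

Lemma realizationP g (s : {set V}) : s \in K -> (forall v, 0 <= g v) ->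
  \sum_v g v = 1 -> (forall v, g v != 0 -> v \in s) ->
  realization R K (g : {ptws V -> R}).
Proof.
move=> sK g0 g1 gs; split=> //; apply: (simplex_sub sK).
  apply/negP => /eqP g00; have /eqP : \sum_v g v = 0.
    apply: big1 => v _; apply/eqP/negPn/negP => gv.
    have : v \in [set v | g v != 0]%SET by rewrite inE.
    by rewrite g00 inE.
  by rewrite g1 oner_eq0.
by apply/fintype.subsetP => v; rewrite inE; exact: gs.
Qed.

(** [pt g] is [o] if [g] does not describe a point of the realization. *)
Variable o : X.

Definition pt g : X :=
  if pselect (realization R K (g : {ptws V -> R})) is left gK
  then SigSub (mem_set gK) else o.

Lemma bc_pt g v : realization R K (g : {ptws V -> R}) -> bc (pt g) v = g v.
Proof. by rewrite /pt; case: pselect. Qed.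

Lemma pt_bc x g : (forall v, g v = bc x v) -> pt g = x.
Proof.
move=> gx; apply: bc_inj => v; rewrite bc_pt // (_ : g = bc x); first exact: bcP.
exact: funext.
Qed.

Lemma pt_continuous (T : topologicalType) (g : T -> V -> R) :
  (forall t, realization R K (g t : {ptws V -> R})) ->
  (forall v, continuous (g ^~ v)) -> continuous (fun t => pt (g t)).
Proof.
move=> gK cg; apply: continuous_set_type; apply: continuous_ptws => v.
by rewrite (_ : (fun t => _) = g ^~ v) //; apply/funext => t; exact: bc_pt.
Qed.

Definition mix g g' (t : R) : V -> R := fun v => (1 - t) * g v + t * g' v.

Definition dirac v : V -> R := fun u => (u == v)%:R.

Lemma dirac_sum v : \sum_u dirac v u = 1.
Proof.
rewrite (bigD1 v) //= /dirac eqxx big1 ?addr0 // => u /negbTE -> //.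
Qed.

Lemma mix_realization g g' (s : {set V}) t : s \in K -> 0 <= t <= 1 ->
  (forall v, 0 <= g v) -> (forall v, 0 <= g' v) ->
  \sum_v g v = 1 -> \sum_v g' v = 1 ->
  (forall v, g v != 0 -> v \in s) -> (forall v, g' v != 0 -> v \in s) ->
  realization R K (mix g g' t : {ptws V -> R}).
Proof.
move=> sK /andP[t0 t1] g0 g0' g1 g1' gs gs'; apply: (realizationP sK).
- by move=> v; rewrite addr_ge0// mulr_ge0// subr_ge0.
- by rewrite big_split /= -!mulr_sumr g1 g1' !mulr1 subrK.
- move=> v; rewrite /mix; case: (eqVneq (g v) 0) => [->|/gs //].
  by case: (eqVneq (g' v) 0) => [->|/gs' //]; rewrite !mulr0 addr0 eqxx.
Qed.

Lemma mix_continuous (T : topologicalType) (g g' : T -> V -> R) (h : T -> R) v :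
  continuous (g ^~ v) -> continuous (g' ^~ v) -> continuous h ->
  continuous (fun t => mix (g t) (g' t) (h t) v).
Proof.
by move=> cg cg' ch; rewrite /mix; solve_continuous.
Qed.

Definition vertex v : X := pt (dirac v).

Lemma vertex_realization v : [set v]%SET \in K ->
  realization R K (dirac v : {ptws V -> R}).
Proof.
move=> vK; apply: (realizationP vK); last first.
- by move=> u; rewrite /dirac inE; case: (u == v); rewrite ?eqxx.
- exact: dirac_sum.
- by move=> u; rewrite /dirac ler0n.
Qed.

Lemma bc_vertex v u : [set v]%SET \in K -> bc (vertex v) u = dirac v u.
Proof. by move=> vK; rewrite bc_pt//; exact: vertex_realization. Qed.

Lemma supp_vertexE v : [set v]%SET \in K -> supp (vertex v) = [set v]%SET.
Proof.
move=> vK; apply/finset.setP => u; rewrite !inE bc_vertex // /dirac.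
by case: (u == v); rewrite ?oner_eq0 ?eqxx.
Qed.

Definition seg x y t : X := pt (mix (bc x) (bc y) t).

(** Both points lie in a common closed simplex, so that the straight segment between them stays in
    the realization. *)
Definition joinable x y := (supp x :|: supp y)%SET \in K.

Lemma seg_realization x y t : joinable x y -> 0 <= t <= 1 ->
  realization R K (mix (bc x) (bc y) t : {ptws V -> R}).
Proof.
move=> xyK t01; apply: (mix_realization xyK) => //; try exact: bc_ge0;
  try exact: bc_sum; by move=> v vs; rewrite !inE vs ?orbT.
Qed.

Lemma bc_seg x y t v : joinable x y -> 0 <= t <= 1 ->
  bc (seg x y t) v = (1 - t) * bc x v + t * bc y v.
Proof. by move=> xyK t01; rewrite bc_pt//; exact: seg_realization. Qed.

Lemma seg0 x y : seg x y 0 = x.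
Proof. by apply: pt_bc => v; rewrite /mix subr0 mul1r mul0r addr0. Qed.

Lemma seg1 x y : seg x y 1 = y.
Proof. by apply: pt_bc => v; rewrite /mix subrr mul1r mul0r add0r. Qed.

Lemma seg_continuous (T : topologicalType) (f f' : T -> X) (h : T -> R) :
  continuous f -> continuous f' -> continuous h ->
  (forall t, joinable (f t) (f' t)) -> (forall t, 0 <= h t <= 1) ->
  continuous (fun t => seg (f t) (f' t) (h t)).
Proof.
move=> cf cf' ch ff' h01; apply: pt_continuous => [t|v].
  exact: seg_realization.
apply: mix_continuous => //.
- by apply: (comp_continuous (g := bc ^~ v)) cf; exact: bc_continuous.
- by apply: (comp_continuous (g := bc ^~ v)) cf'; exact: bc_continuous.
Qed.

Lemma uval01 (t : I) : 0 <= uval t <= 1.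
Proof. by rewrite uval_ge0 uval_le1. Qed.

(** The closed star of [w]; the condition forces [w] to be a vertex of the complex. *)
Definition cstar w x := (w |: supp x)%SET \in K.

Lemma cstar_vertex w x : cstar w x -> [set w]%SET \in K.
Proof.
move=> wx; apply: (simplex_sub wx); last by rewrite finset.sub1set !inE eqxx.
by apply/set0Pn; exists w; rewrite inE.
Qed.

Lemma cstar_joinable w x : cstar w x -> joinable x (vertex w).
Proof.
by move=> wx; rewrite /joinable (supp_vertexE (cstar_vertex wx)) finset.setUC.
Qed.

(** The straight-line contraction to [w] takes both paths to the same constant tuple and moves their
    common ends in the same way. *)
Lemma star_homotopic (n : nat) w (p q : I -> {ptws 'I_n -> X}) :
  continuous p -> continuous q ->
  (forall t j, cstar w (p t j)) -> (forall t j, cstar w (q t j)) ->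
  p zero = q zero -> p one = q one ->
  path_homotopic (p zero) (p one) p q.
Proof.
move=> cp cq wp wq pq0 pq1.
pose G (r : I -> {ptws 'I_n -> X}) (st : I * I) : {ptws 'I_n -> X} :=
  fun j => seg (r st.1 j) (vertex w) (uval st.2).
have key (r : I -> {ptws 'I_n -> X}) : continuous r ->
    (forall t j, cstar w (r t j)) ->
    [/\ continuous (G r), forall s, G r (s, zero) = r s
      & forall s, G r (s, one) = fun=> vertex w].
  move=> cr wr; split=> [|s|s].
  - apply: continuous_ptws => j; apply: seg_continuous.
    + apply: (comp_continuous (g := fun t => r t j)); last by solve_continuous.
      exact: ptws_proj_continuous.
    + exact: cstr_continuous.
    + by solve_continuous.
    + by move=> t; exact: cstar_joinable.
    + by move=> t; exact: uval01.
  - by apply/funext => j; rewrite /G /= uval_zero seg0.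
  - by apply/funext => j; rewrite /G /= uval_one seg1.
have [cGp Gp0 Gp1] := key p cp wp; have [cGq Gq0 Gq1] := key q cq wq.
apply: (homotopic_contract cGp cGq Gp0 Gq0 Gp1 Gq1) => t.
- by rewrite /G /= pq0.
- by rewrite /G /= pq1.
Qed.

(** Inside a star only the ends of a path matter: any path of configurations that joins them there
    can replace it. *)
Lemma deformable_star (n : nat) w (p : I -> {ptws 'I_n -> X}) :
  continuous p -> (forall t j, cstar w (p t j)) ->
  conn R (cstar w) (p zero) (p one) -> deformable (@config_space X n) p.
Proof.
move=> cp wp [q [cq q0 q1 Fq wq]]; exists q; split=> //.
by apply: (star_homotopic (w := w)).
Qed.

End realization.

Arguments bc {R V K} x v.

(** * Passing points at a tripod *)

Section tripod.
Context {R : realType} {V : finType} (K : simplicial_complex V).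
Local Notation I := (unit_itv R).
Local Notation X := (realization R K).
Variable o : X.

Definition lineg (w u u' : V) (s : R) : V -> R := fun v =>
  Num.max 0 s * dirac u v + Num.max 0 (- s) * dirac u' v +
  (1 - (Num.max 0 s + Num.max 0 (- s))) * dirac w v.

(** Positive parameters lie on the edge [w u], negative ones on [w u']. *)
Definition line w u u' s : X := pt o (lineg w u u' s).

Definition fork (w u u' : V) :=
  [/\ u != u', w != u, w != u', [set w; u]%SET \in K & [set w; u']%SET \in K].

Section line.
Variables (w u u' : V).
Hypothesis wuu' : fork w u u'.
Implicit Types s : R.

Lemma line_realization s : -1 <= s <= 1 ->
  realization R K (lineg w u u' s : {ptws V -> R}).
Proof.
move=> s1; have [uu' wu wu' uK u'K] := wuu'.
have m1 : Num.max 0 s + Num.max 0 (- s) <= 1 by interval_cases; lra.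
have m0 r : 0 <= Num.max 0 r :> R by rewrite le_max lexx.
have d0 v v' : 0 <= dirac v v' :> R by rewrite /dirac ler0n.
have g0 v : 0 <= lineg w u u' s v.
  by rewrite /lineg !addr_ge0// mulr_ge0// subr_ge0.
have g1 : \sum_v lineg w u u' s v = 1.
  by rewrite /lineg !big_split /= -!mulr_sumr !dirac_sum; lra.
have [s0|s0] := lerP 0 s.
  apply: (realizationP uK g0 g1) => v; rewrite !inE /lineg /dirac.
  rewrite (_ : Num.max 0 (- s) = 0) ?mul0r ?addr0; last by interval_cases; lra.
  by case: (v == w); case: (v == u) => //=; rewrite !mulr0 addr0 eqxx.
apply: (realizationP u'K g0 g1) => v; rewrite !inE /lineg /dirac.
rewrite (_ : Num.max 0 s = 0) ?mul0r ?add0r; last by interval_cases; lra.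
by case: (v == w); case: (v == u') => //=; rewrite !mulr0 addr0 eqxx.
Qed.

Lemma bc_line s v : -1 <= s <= 1 ->
  bc (line w u u' s) v = lineg w u u' s v.
Proof. by move=> s1; rewrite bc_pt//; exact: line_realization. Qed.

Lemma bc_line_pos s : -1 <= s <= 1 -> bc (line w u u' s) u = Num.max 0 s.
Proof.
move=> s1; have [uu' wu _ _ _] := wuu'.
rewrite bc_line // /lineg /dirac eqxx eq_sym in wu *.
by rewrite (negbTE wu) (negbTE uu') !mulr0 mulr1 !addr0.
Qed.

Lemma bc_line_neg s : -1 <= s <= 1 -> bc (line w u u' s) u' = Num.max 0 (- s).
Proof.
move=> s1; have [uu' _ wu' _ _] := wuu'.
rewrite bc_line // /lineg /dirac eqxx eq_sym [u' == u]eq_sym in wu' *.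
by rewrite (negbTE wu') (negbTE uu') !mulr0 mulr1 addr0 add0r.
Qed.

(** The coordinates at [u] and [u'] are the positive and negative parts of the parameter. *)
Lemma line_inj s (t : R) : -1 <= s <= 1 -> -1 <= t <= 1 ->
  line w u u' s = line w u u' t -> s = t.
Proof.
move=> s1 t1 st; have := congr1 (bc ^~ u) st; have := congr1 (bc ^~ u') st.
by rewrite /= !bc_line_pos // !bc_line_neg //; interval_cases; lra.
Qed.

Lemma line_cstar s : -1 <= s <= 1 -> cstar w (line w u u' s).
Proof.
move=> s1; have [uu' wu wu' uK u'K] := wuu'.
have sub (z : V) : [set w; z]%SET \in K ->
    supp (line w u u' s) \subset [set w; z]%SET -> cstar w (line w u u' s).
  move=> zK sz; apply: (simplex_sub zK).
    by apply/set0Pn; exists w; rewrite !inE eqxx.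
  by rewrite finset.subUset sz andbT finset.sub1set !inE eqxx.
have [s0|s0] := lerP 0 s.
  apply: (sub u) => //; apply/fintype.subsetP => v.
  rewrite !inE bc_line // /lineg /dirac.
  rewrite (_ : Num.max 0 (- s) = 0) ?mul0r ?addr0; last by interval_cases; lra.
  by case: (v == w); case: (v == u) => //=; rewrite !mulr0 addr0 eqxx.
apply: (sub u') => //; apply/fintype.subsetP => v.
rewrite !inE bc_line // /lineg /dirac.
rewrite (_ : Num.max 0 s = 0) ?mul0r ?add0r; last by interval_cases; lra.
by case: (v == w); case: (v == u') => //=; rewrite !mulr0 addr0 eqxx.
Qed.

Lemma line_continuous (T : topologicalType) (f : T -> R) :
  continuous f -> (forall t, -1 <= f t <= 1) ->
  continuous (fun t => line w u u' (f t)).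
Proof.
move=> cf f1; apply: pt_continuous => [t|v]; first exact: line_realization.
rewrite /lineg; solve_continuous.
Qed.

(** A common translation keeps the differences of the parameters, so the sliding points never
    collide; the points in [A] rest off the line. Being in range at both ends suffices by
    convexity. *)
Lemma slide (n : nat) (A : pred 'I_n) (c : 'I_n -> X) (r : 'I_n -> R) (d : R) :
  (forall i j, A i -> A j -> i != j -> c i <> c j) ->
  (forall i, A i -> cstar w (c i)) ->
  (forall i s, A i -> -1 <= s <= 1 -> line w u u' s <> c i) ->
  (forall i j, i != j -> ~~ A i -> ~~ A j -> r i <> r j) ->
  (forall i, ~~ A i -> -1 <= r i <= 1 /\ -1 <= r i + d <= 1) ->
  conn R (cstar w)
    ((fun j => if A j then c j else line w u u' (r j)) : {ptws 'I_n -> X})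
    (fun j => if A j then c j else line w u u' (r j + d)).
Proof.
move=> cc cw cl rr r1.
have rt1 i (t : I) : ~~ A i -> -1 <= r i + uval t * d <= 1.
  move=> /r1[r1a r1b]; have := uval_ge0 t; have := uval_le1 t.
  by move: (uval t) => x x1 x0; nra.
exists (fun t => (fun j => if A j then c j
                  else line w u u' (r j + uval t * d)) : {ptws 'I_n -> X}).
split=> [|||t i j ij|t j].
- apply: continuous_ptws => j; have [Aj|/negP Aj] := boolP (A j).
    exact: cstr_continuous.
  apply: line_continuous; first by solve_continuous.
  by move=> t; exact/rt1/negP.
- by apply/funext => j; rewrite uval_zero mul0r addr0.
- by apply/funext => j; rewrite uval_one mul1r.
- have [Ai|Ai] := ifPn; have [Aj|Aj] := ifPn.
  + exact: cc.
  + by move=> /esym; apply: cl => //; exact: rt1.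
  + by apply: cl => //; exact: rt1.
  + move/line_inj => /(_ (rt1 _ _ Ai) (rt1 _ _ Aj)) /addIr; exact: rr.
- by case: ifPn => Aj; [exact: cw|apply/line_cstar/rt1].
Qed.

End line.

Lemma conn_move (n : nat) (T : set X) (c : {ptws 'I_n -> X}) k (g : I -> X) :
  config_space X n c -> continuous g -> g zero = c k ->
  (forall t j, j != k -> c j <> g t) ->
  (forall j, T (c j)) -> (forall t, T (g t)) ->
  conn R T c (upd c k (g one) : {ptws 'I_n -> X}).
Proof.
move=> Fc cg g0 cgN Tc Tg.
exists (fun t => upd c k (g t) : {ptws 'I_n -> X}); split=> //.
- exact: upd_cts.
- by rewrite g0 upd_id.
- by move=> t; apply: upd_config => // j; exact: cgN.
- by move=> t j; rewrite /upd; case: ifP.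
Qed.

Section line_swap.
Variables (w u1 u2 u3 : V).
Hypotheses (f12 : fork w u1 u2) (f32 : fork w u3 u2) (u13 : u1 != u3).

Let bc_line_third s : -1 <= s <= 1 -> bc (line w u1 u2 s) u3 = 0.
Proof.
move=> s1; have [_ w3 u32 _ _] := f32; rewrite bc_line // /lineg /dirac.
rewrite [u3 == u1]eq_sym [u3 == w]eq_sym (negbTE u13) (negbTE w3).
by rewrite (negbTE (let: And5 p _ _ _ _ := f32 in p)) !mulr0 !addr0.
Qed.

(** To bring the point [k] past others, slide the configuration until [k] is
    at [w], park [k] in the third edge, slide the others and bring [k] back. *)
Lemma line_swap (n : nat) (s : 'I_n -> R) (k : 'I_n) (y : R) :
  injective s -> (forall j, 0 <= s j <= 1) -> 0 <= y <= 1 ->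
  (forall j, j != k -> s j <> y) ->
  conn R (cstar w) ((fun j => line w u1 u2 (s j)) : {ptws 'I_n -> X})
    (fun j => line w u1 u2 (upd s k y j)).
Proof.
move=> s_inj s01 y01 sy.
have sk01 := s01 k.
have w0 : line w u1 u2 0 = line w u3 u2 0.
  apply: bc_inj => v; rewrite !bc_line //; try lra.
  by rewrite /lineg oppr0 maxxx !mul0r.
have third j t : -1 <= j <= 1 -> 0 <= t <= 1 -> j <> 0 ->
    line w u1 u2 j <> line w u3 u2 t.
  move=> j1 t1 j0 jt; have t1' : -1 <= t <= 1 by lra.
  have := congr1 (bc ^~ u3) jt; rewrite /= bc_line_third // bc_line_pos //.
  rewrite (max_idPr _); last lra.
  move=> t0; move: jt; rewrite -t0 -w0 => /(line_inj f12 j1).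
  by move=> jt; apply: j0; apply: jt; lra.
(* The point [k] leaves [w] for the vertex [u3]. By [third], its way meets the first line only at
   [w], where no other point is. *)
have park (r : 'I_n -> R) : (forall j, j != k -> -1 <= r j <= 1) ->
    (forall j, j != k -> r j <> 0) ->
    (forall i j, i != j -> i != k -> j != k -> r i <> r j) ->
    r k = 0 ->
    conn R (cstar w) ((fun j => line w u1 u2 (r j)) : {ptws 'I_n -> X})
     (fun j => if j == k then line w u3 u2 1 else line w u1 u2 (r j)).
  move=> r1 r0 rr rk0.
  have r1' j : -1 <= r j <= 1.
    by case: (eqVneq j k) => [->|/r1//]; rewrite rk0; lra.
  pose g (t : I) : X := line w u3 u2 (uval t).
  have g1 (t : I) : -1 <= uval t <= 1.
    by have := uval_ge0 t; have := uval_le1 t; lra.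
  have := @conn_move n (cstar w) (fun j => line w u1 u2 (r j)) k g.
  rewrite /g uval_one => H.
  rewrite (_ : (fun j => if j == k then _ else _) =
    upd (fun j => line w u1 u2 (r j)) k (line w u3 u2 1)) //.
  apply: H.
  - move=> i j ij /line_inj => /(_ f12 (r1' i) (r1' j)) rij.
    have [ik|ik] := eqVneq i k.
      rewrite ik rk0 in rij ij; rewrite eq_sym in ij.
      exact: r0 ij (esym rij).
    have [jk|jk] := eqVneq j k; first by rewrite jk rk0 in rij; exact: r0 rij.
    exact: rr rij.
  - by apply: line_continuous => //; exact: uval_continuous.
  - by rewrite uval_zero rk0.
  - move=> t j jk; apply: third => //; [|exact: r0].
    by rewrite uval_ge0 uval_le1.
  - by move=> j; exact: line_cstar.
  - by move=> t; exact: line_cstar.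
have cst01 : cstar w (line w u3 u2 1) by apply: line_cstar => //; lra.
have s_neq i j : i != j -> s i <> s j.
  by move=> /eqP ij /s_inj.
have slide0 (r : 'I_n -> R) d : (forall i j, i != j -> r i <> r j) ->
    (forall i, -1 <= r i <= 1 /\ -1 <= r i + d <= 1) ->
    conn R (cstar w) ((fun j => line w u1 u2 (r j)) : {ptws 'I_n -> X})
      (fun j => line w u1 u2 (r j + d)).
  move=> rr r1.
  by apply: (@slide _ _ _ f12 n pred0 (fun=> o) r d) => // i j ij _ _; exact: rr.
(* The shift puts [k] at [w]. All parameters were in [[0, 1]], so the differences are in [[-1, 1]]:
   the edge to [u2] is the room for points that slide past [w]. *)
apply: (@conn_trans _ _ _ _ (fun j => line w u1 u2 (s j - s k))).
  apply: slide0 => // i; have := s01 i; lra.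
apply: (@conn_trans _ _ _ _
  (fun j => if j == k then line w u3 u2 1 else line w u1 u2 (s j - s k))).
  apply: park => [j _|j jk|i j ij _ _ /addIr|].
  - have := s01 j; lra.
  - by move/eqP; rewrite subr_eq0 => /eqP; exact: s_neq.
  - exact: s_neq.
  - by rewrite subrr.
apply: (@conn_trans _ _ _ _
  (fun j => if j == k then line w u3 u2 1 else line w u1 u2 (s j - y))).
  rewrite (_ : (fun j => if _ then _ else line _ _ _ (s j - y)) =
    (fun j => if j == k then line w u3 u2 1
              else line w u1 u2 (s j - s k + (s k - y)))); last first.
    by apply/funext => j; rewrite addrA subrK.
  apply: (@slide _ _ _ f12 n (pred1 k) (fun=> line w u3 u2 1)
    (fun j => s j - s k)) => //=.
  - by move=> i j /eqP -> /eqP ->; rewrite eqxx.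
  - move=> i t _ t1 /(congr1 (bc ^~ u3)) /=.
    rewrite bc_line_third // bc_line_pos //; last lra.
    by interval_cases; lra.
  - by move=> i j ij _ _ /addIr; exact: s_neq.
  - by move=> i _; have := s01 i; lra.
(* The target configuration shifted by [- y]. Its point [k] is at [w], so [park] read backwards
   brings it in from [u3]. *)
pose r j := upd s k y j - y.
rewrite (_ : (fun j => if _ then _ else _) =
  (fun j => if j == k then line w u3 u2 1 else line w u1 u2 (r j))); last first.
  by apply/funext => j; rewrite /r /upd; case: eqP.
have r_neq i j : i != j -> r i <> r j.
  rewrite /r /upd => ij /addIr.
  have [ik|ik] := eqVneq i k; have [jk|jk] := eqVneq j k.
  - by rewrite ik jk eqxx in ij.
  - by move=> /esym; exact: sy.
  - exact: sy.
  - exact: s_neq.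
have r1 i : -1 <= r i <= 1 /\ -1 <= r i + y <= 1.
  by rewrite /r /upd; case: eqP => _; have := s01 i; lra.
apply: (@conn_trans _ _ _ _ (fun j => line w u1 u2 (r j))).
  apply: conn_sym; apply: park => [j _|j jk|i j ij _ _|].
  - exact: (r1 j).1.
  - by rewrite /r updN // => /eqP; rewrite subr_eq0 => /eqP; exact: sy.
  - exact: r_neq.
  - by rewrite /r updE subrr.
rewrite (_ : (fun j => line _ _ _ (upd s k y j)) =
   fun j => line w u1 u2 (r j + y)).
  exact: slide0.
by apply/funext => j; rewrite /r subrK.
Qed.

End line_swap.
End tripod.

(** * Moving points up to relabelling *)

Section reach.
Context {R : realType} {V : finType} (K : simplicial_complex V) {n : nat}.
Local Notation I := (unit_itv R).
Local Notation X := (realization R K).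
Local Notation Z := {ptws 'I_n -> X}.
Variable o : X.
Implicit Types (x y z : X) (c d : 'I_n -> X).

(** Connected up to a permutation of the labels. *)
Definition uconn (c d : Z) := exists2 s : 'I_n -> 'I_n, injective s &
  conn R setT c (fun j => d (s j)).

Lemma conn_perm T (c d : Z) (s : 'I_n -> 'I_n) : injective s ->
  conn R T c d ->
  conn R T ((fun j => c (s j)) : Z) (fun j => d (s j)).
Proof.
move=> s_inj [f [cf f0 f1 Ff Tf]].
exists (fun t => (fun j => f t (s j)) : Z); split=> //.
- apply: continuous_ptws => j.
  exact: (@ptws_proj_continuous _ _ _ f (s j)).
- by rewrite f0.
- by rewrite f1.
- move=> t i j /eqP ij; apply: Ff; by apply/eqP => /s_inj.
Qed.

Lemma uconn_trans (c d e : Z) : uconn c d -> uconn d e -> uconn c e.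
Proof.
move=> [s s_inj cd] [t t_inj de]; exists (t \o s); first exact: inj_comp.
exact: conn_trans cd (conn_perm s_inj de).
Qed.

Lemma conn_uconn (c d : Z) : conn R setT c d -> uconn c d.
Proof. by move=> cd; exists id. Qed.

Lemma uconn_config (c d : Z) : uconn c d -> config_space X n d.
Proof.
move=> [s s_inj /conn_config Fd] i j ij.
have [t ts st] := injF_bij s_inj.
by rewrite -[i]st -[j]st; apply: Fd; rewrite (can_eq st).
Qed.

(** When [c j = z], moving [j] to [y] and then [i] to [z] moves [i] to [y] up
    to exchanging the labels [i] and [j]. *)
Lemma uconn_via c i j y : i != j ->
  uconn c (upd c j y) ->
  uconn (upd c j y) (upd (upd c j y) i (c j)) ->
  uconn c (upd c i y).
Proof.
move=> ij cj ci; apply: uconn_trans (uconn_trans cj ci) _.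
pose s l := if l == i then j else if l == j then i else l.
have sK : involutive s.
  move=> l; rewrite /s; have [->|li] := eqVneq l i.
    by rewrite eqxx eq_sym (negbTE ij).
  have [->|lj] := eqVneq l j; first by rewrite eqxx.
  by rewrite (negbTE li) (negbTE lj).
have updE2 : upd (upd c j y) i (c j) = fun l => upd c i y (s l).
  apply/funext => l; rewrite /s /upd; have [li|li] := eqVneq l i.
    by rewrite eq_sym (negbTE ij).
  have [lj|lj] := eqVneq l j; first by rewrite eqxx.
  by rewrite (negbTE li).
exists s; first exact: inv_inj.
rewrite updE2; apply: conn_refl => //; rewrite -updE2.
exact: uconn_config ci.
Qed.

Definition mid x y z := exists2 t : R, 0 < t < 1 & z = seg o x y t.

Lemma seg_inj x y a b : joinable x y -> x <> y -> 0 <= a <= 1 -> 0 <= b <= 1 ->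
  seg o x y a = seg o x y b -> a = b.
Proof.
move=> xyK xy a01 b01 ab; apply: contrapT => /eqP aneb.
apply: xy; apply: bc_inj => v; have := congr1 (bc ^~ v) ab.
rewrite /= !bc_seg // => /eqP; rewrite -subr_eq0.
rewrite (_ : _ - _ = (a - b) * (bc y v - bc x v)); last by ring.
by rewrite mulf_eq0 subr_eq0 (negbTE aneb) /= subr_eq0 => /eqP.
Qed.

Lemma seg_joinable x y t : joinable x y -> 0 <= t <= 1 ->
  joinable x (seg o x y t) /\ joinable (seg o x y t) y.
Proof.
move=> xyK t01.
have st : supp (seg o x y t) \subset (supp x :|: supp y)%SET.
  apply/fintype.subsetP => v; rewrite !inE bc_seg //; apply: contraR.
  by rewrite negb_or !negbK => /andP[/eqP-> /eqP->]; rewrite !mulr0 addr0.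
have nx : supp x != finset.set0 by exact/simplex_neq0/supp_simplex.
have ny : supp y != finset.set0 by exact/simplex_neq0/supp_simplex.
split; apply: (simplex_sub xyK).
- by apply: contraNneq nx; move/eqP; rewrite finset.setU_eq0 => /andP[].
- by rewrite finset.subUset finset.subsetUl.
- by apply: contraNneq ny; move/eqP; rewrite finset.setU_eq0 => /andP[].
- by rewrite finset.subUset finset.subsetUr andbT.
Qed.

Lemma seg_segr x y a t : joinable x y -> 0 <= a <= 1 -> 0 <= t <= 1 ->
  seg o (seg o x y a) y t = seg o x y (a + t * (1 - a)).
Proof.
move=> xyK a01 t01; have [_ K1] := seg_joinable xyK a01.
by apply: bc_inj => v; rewrite !bc_seg //; [ring|nra].
Qed.

Lemma seg_segl x y a t : joinable x y -> 0 <= a <= 1 -> 0 <= t <= 1 ->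
  seg o x (seg o x y a) t = seg o x y (t * a).
Proof.
move=> xyK a01 t01; have [K1 _] := seg_joinable xyK a01.
by apply: bc_inj => v; rewrite !bc_seg //; [ring|nra].
Qed.

(** Quantifying over all configurations with [y] free makes the relation transitive even when the
    intermediate position is occupied. *)
Definition reach x y := forall (c : Z) i, config_space X n c -> c i = x ->
  (forall j, c j <> y) -> uconn c (upd c i y).

(** Induction on the number of points strictly inside the segment. A point [j] inside is first sent
    on to [y], then [i] takes its place. Each of the two shorter segments contains fewer points, as
    [j] is no longer counted. *)
Lemma joinable_reach x y : joinable x y -> reach x y.
Proof.
pose inside c x y := [set j | `[< mid x y (c j) >]]%SET.
suff H m : forall x y c i, joinable x y -> (#|inside c x y| < m)%N ->
    config_space X n (c : Z) -> c i = x -> (forall j, c j <> y) ->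
    uconn c (upd c i y).
  by move=> xyK c i; exact: (H #|inside c x y|.+1 x y c i xyK (ltnSn _)).
elim: m => // m IH {}x {}y c i xyK; rewrite ltnS => cm Fc cx cy.
have xy : x <> y by rewrite -cx; exact: cy.
have [|/set0Pn [j]] := eqVneq (inside c x y) finset.set0.
  move=> noj; apply: conn_uconn.
  have -> : upd c i y = upd c i (seg o x y (uval (one : I))).
    by rewrite uval_one seg1.
  apply: (conn_move (g := fun t : I => seg o x y (uval t))) => //.
  - apply: seg_continuous; try exact: cstr_continuous; first exact: uval_continuous.
    + by [].
    + exact: uval01.
  - by rewrite uval_zero seg0 cx.
  - move=> t j ji; have := uval_ge0 t; rewrite le_eqVlt => /predU1P[<-|t0].
      by rewrite seg0 -cx; exact: Fc.
    have := uval_le1 t; rewrite le_eqVlt => /predU1P[->|t1].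
      by rewrite seg1.
    move=> cjt; have : j \in inside c x y.
      by rewrite inE; apply/asboolP; exists (uval t) => //; apply/andP.
    by rewrite noj inE.
rewrite inE => /asboolP [t t01 cjt].
have t01' : 0 <= t <= 1 by lra.
have [xzK zyK] := seg_joinable xyK t01'; rewrite -cjt in xzK zyK.
have ij : i != j.
  apply/eqP => ij; move: cjt; rewrite -ij cx -{1}(seg0 o x y).
  by move/(seg_inj xyK xy) => H; have : 0 = t by [apply: H; lra]; lra.
have jin : j \in inside c x y by rewrite inE; apply/asboolP; exists t.
have c'F := @upd_config _ _ c j y Fc (fun l _ => cy l).
apply: (uconn_via ij).
  apply: (IH (c j)) => //; apply: leq_trans cm; apply: proper_card.
  apply/fintype.properP; split.
    apply/fintype.subsetP => l; rewrite !inE => -[s s01].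
    rewrite cjt seg_segr //; last lra.
    move=> cl; exists (t + s * (1 - t)); last by [].
    by apply/andP; split; nra.
  exists j => //; rewrite inE; apply/asboolP => -[s s01].
  rewrite cjt seg_segr //; last lra.
  by move/(seg_inj xyK xy) => H; have : t = t + s * (1 - t) by [apply: H; nra]; nra.
have notj : j \notin inside (upd c j y) x (c j).
  rewrite inE updE; apply/asboolP => -[s s01].
  rewrite cjt seg_segl //; last lra.
  rewrite -{1}(seg1 o x y).
  by move/(seg_inj xyK xy) => H; have : 1 = s * t by [apply: H; nra]; nra.
apply: (IH x) => //.
- apply: leq_trans cm; apply: proper_card; apply/fintype.properP.
  split; last by exists j.
  apply/fintype.subsetP => l; have [->|lj] := eqVneq l j.
    by rewrite (negbTE notj).
  rewrite !inE updN // => -[s s01].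
  rewrite cjt seg_segl //; last lra.
  move=> cl; exists (s * t); last by [].
  by apply/andP; split; nra.
- by rewrite updN.
- move=> l; have [->|lj] := eqVneq l j; first by rewrite updE => /esym; exact: cy.
  by rewrite updN //; exact: Fc.
Qed.

(** If [y] is occupied, its occupant moves on to [z] and [i] takes its place; up to labels this
    brings [i] to [z]. *)
Lemma reach_trans x y z : reach x y -> reach y z -> reach x z.
Proof.
move=> xy yz c i Fc cx cz.
have [[j cj]|cy] := pselect (exists j, c j = y); last first.
  have {}cy j : c j <> y by move=> cj; apply: cy; exists j.
  have [<-|zy] := pselect (y = z); first exact: xy.
  apply: uconn_trans (xy c i Fc cx cy) _.
  rewrite (_ : upd c i z = upd (upd c i y) i z); last first.
    by apply/funext => l; rewrite /upd; case: eqP.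
  apply: yz; rewrite ?updE //; first exact: upd_config.
  move=> l; have [->|li] := eqVneq l i; first by rewrite updE.
  by rewrite updN.
have [ij|ij] := eqVneq i j; first by apply: yz => //; rewrite ij.
apply: (uconn_via ij); first exact: yz.
rewrite cj; apply: xy.
- by apply: upd_config => // l _; exact: cz.
- by rewrite updN.
- move=> l; have [->|lj] := eqVneq l j; first by rewrite updE -cj => /esym/cz.
  by rewrite updN // -cj; exact: Fc.
Qed.

End reach.

(** * Connectedness of the vertex graph and gathering on one edge *)

Section connectivity.
Context {R : realType} {V : finType} (K : simplicial_complex V).
Local Notation X := (realization R K).
Variable o : X.
Hypothesis connectedX : connected [set: X].
Implicit Types (x y : X) (u v w : V).

(** Reflexive exactly at the vertices of the complex, so an edge path may pause. *)
Definition adj : rel V := fun u v => [set u; v]%SET \in K.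

Lemma adj_sym : symmetric adj.
Proof. by move=> u v; rewrite /adj finset.setUC. Qed.

Lemma adj_vertex u v : adj u v -> [set u]%SET \in K.
Proof.
move=> uv; apply: (simplex_sub uv); last by rewrite finset.sub1set !inE eqxx.
by apply/set0Pn; exists u; rewrite inE.
Qed.

Lemma simplex_adj (s : {set V}) u v :
  s \in K -> u \in s -> v \in s -> adj u v.
Proof.
move=> sK us vs; apply: (simplex_sub sK).
  by apply/set0Pn; exists u; rewrite !inE eqxx.
by rewrite finset.subUset !finset.sub1set us vs.
Qed.

(** The total weight on the component of [u] is continuous. Supports are cliques, so it takes only
    the values 0 and 1, and connectedness makes it constant. *)
Lemma vertex_connect u v :
  [set u]%SET \in K -> [set v]%SET \in K -> connect adj u v.
Proof.
move=> uK vK; pose S := [set v | connect adj u v]%SET.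
pose f x := \sum_(v in S) bc x v.
have cf : continuous f.
  by apply: sum_continuous => v0; exact: bc_continuous.
have f01 x : f x = 0 \/ f x = 1.
  have [v0 v0x] := supp_neq0 x.
  have vS v1 : v1 \in supp x -> (v1 \in S) = (v0 \in S).
    move=> v1x; rewrite !inE; apply/idP/idP => /connect_trans; apply;
      apply/connect1; exact: simplex_adj (supp_simplex x) _ _.
  have [v0S|v0S] := boolP (v0 \in S); [right|left]; last first.
    apply: big1 => v1 v1S; apply/eqP; apply: contraNT v0S => v1x.
    by rewrite -(vS v1) // inE.
  rewrite -(bc_sum x) /f big_mkcond /=; apply: eq_bigr => v1 _.
  case: ifPn => // v1S; apply/esym/eqP; apply: contraNT v1S => v1x.
  by rewrite (vS v1) // inE.
have /connectedX : [set x | 2^-1 < f x] !=set0.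
  exists (vertex o u) => /=; rewrite /f (bigD1 u) /=; last by rewrite inE.
  rewrite bc_vertex // /dirac eqxx big1 ?addr0 /=; first by lra.
  by move=> v0 /andP[_ /negbTE vu]; rewrite bc_vertex // /dirac vu.
(* Since 1/2 is not a value of [f], the strict and the weak inequality define the same set, which is
   therefore open and closed. *)
move=> H; have {}H : [set x | 2^-1 < f x] = setT.
  apply: H.
    exists [set x | 2^-1 < f x]; last by rewrite setTI.
    by apply: (@open_comp _ _ f [set r | 2^-1 < r]) => //; exact: open_gt.
  exists [set x | 2^-1 <= f x].
    by apply: (@closed_comp _ _ f [set r | 2^-1 <= r]) => //; exact: closed_ge.
  rewrite setTI; apply/seteqP; split=> x /=; first exact: ltW.
  by case: (f01 x) => ->; lra.
have : [set x | 2^-1 < f x] (vertex o v) by rewrite H.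
rewrite /= /f; case: (boolP (v \in S)); first by rewrite inE.
move=> vS; rewrite big1; first by lra.
move=> v0 v0S; rewrite bc_vertex // /dirac; case: eqP => // v0v.
by rewrite v0v (negbTE vS) in v0S.
Qed.

Lemma reach_all (n : nat) x y : reach (n := n) x y.
Proof.
have vertex_reach v z : v \in supp z ->
    joinable (vertex o v) z /\ joinable z (vertex o v).
  move=> vz; rewrite /joinable (supp_vertexE _ (supp_vertex vz)).
  rewrite [(supp z :|: _)%SET]finset.setUC.
  by rewrite (finset.setUidPr _) ?supp_simplex ?finset.sub1set.
have [u ux] := supp_neq0 x; have [v vy] := supp_neq0 y.
apply: (@reach_trans _ _ _ _ _ (vertex o u)).
  exact: joinable_reach (vertex_reach _ _ ux).2.
apply: (@reach_trans _ _ _ _ _ (vertex o v)); last first.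
  exact: joinable_reach (vertex_reach _ _ vy).1.
have /connectP [p] := vertex_connect (supp_vertex ux) (supp_vertex vy).
elim: p u {ux} => [u _ ->|u' p IH u /= /andP[uu' pathp] vE].
  (* A position is never free for the point that occupies it, so [reach] from a point to itself is
     vacuous. *)
  by move=> c i _ <- /(_ i).
apply: (@reach_trans _ _ _ _ _ (vertex o u')); last exact: IH.
apply: (@joinable_reach _ _ _ _ o); have uK := adj_vertex uu'.
have adj_u' := uu'; rewrite adj_sym in adj_u'; have u'K := adj_vertex adj_u'.
by rewrite /joinable (supp_vertexE _ uK) (supp_vertexE _ u'K).
Qed.

(** Induction on the number of points outside the open edge: one of them is brought to a free place
    on it. Relabelling does not change this number. *)
Lemma gather (n : nat) w u u' (c : 'I_n -> X) : fork K w u u' ->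
  config_space X n (c : {ptws 'I_n -> X}) ->
  exists2 d : {ptws 'I_n -> X}, conn R setT c d &
    forall j, exists2 s : R, 0 < s < 1 & d j = line o w u u' s.
Proof.
move=> wuu'; pose P x := exists2 s : R, 0 < s < 1 & x = line o w u u' s.
suff H m : forall c : {ptws 'I_n -> X},
    (#|[set j | ~~ `[< P (c j) >]]%SET| < m)%N -> config_space X n c ->
    exists2 d : {ptws 'I_n -> X}, conn R setT c d & forall j, P (d j).
  by move=> Fc; exact: H (ltnSn _) Fc.
elim: m => // m IH {}c; rewrite ltnS => cm Fc.
have [c0|/set0Pn [i]] := eqVneq [set j | ~~ `[< P (c j) >]]%SET finset.set0.
  exists c; first exact: conn_refl.
  move=> j; apply: contrapT => cj; have : j \in finset.set0.
    by rewrite -c0 inE; apply/asboolP.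
  by rewrite inE.
move=> ci.
have [s s01 cs] : exists2 s : R, 0 < s < 1 & forall j, c j <> line o w u u' s.
  apply: contrapT => nos.
  (* Of [n + 1] distinct parameters, [n] points cannot occupy all. *)
  pose r (k : 'I_n.+1) : R := k.+1%:R / n.+2%:R.
  have r01 k : 0 < r k < 1.
    rewrite /r divr_gt0 ?ltr0n //= ltr_pdivrMr ?ltr0n // mul1r ltr_nat ltnS.
    exact: ltn_ord.
  have /choice [f fP] : forall k, exists j, c j = line o w u u' (r k).
    move=> k; apply: contrapT => nok; apply: nos; exists (r k) => // j cj.
    by apply: nok; exists j.
  have f_inj : injective f.
    move=> k l kl; have := fP l; rewrite -kl fP => /(line_inj wuu') kl'.
    have /(divIf _) : r k = r l.
      by apply: kl'; [have := r01 k|have := r01 l]; lra.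
    by rewrite pnatr_eq0 => /(_ isT) /eqP; rewrite eqr_nat => /eqP [] /val_inj.
  by have := leq_card f f_inj; rewrite !card_ord ltnn.
have [t t_inj ct] := reach_all Fc (erefl (c i)) cs.
have Fd := conn_config ct.
have [||d cd dP] := IH (fun j => upd c i (line o w u u' s) (t j)) _ _.
- apply: leq_trans cm; rewrite -(card_imset _ t_inj).
  apply: proper_card; apply/fintype.properP; split; last first.
    exists i => //; apply/imsetP => -[j + ij]; rewrite inE -ij updE.
    by move/asboolP; apply; exists s.
  apply/fintype.subsetP => _ /imsetP [j jP ->]; move: jP; rewrite !inE.
  have [->|ji] := eqVneq (t j) i; last by rewrite updN.
  by rewrite updE => /asboolP; case; exists s.
- exact: Fd.
- by exists d => //; exact: conn_trans ct cd.
Qed.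

End connectivity.

(** * Approximation by edge paths *)

(** A hereditary property of sets replaces the open cover, and the radius has the form [1 / (N + 1)]
    to suit equal subdivisions. *)
Lemma lebesgue_number (R : realType) (Q : set R -> Prop) :
  (forall A B, A `<=` B -> Q B -> Q A) ->
  (forall x : R, 0 <= x <= 1 -> exists2 e : R, 0 < e & Q [set t | `|t - x| < e]) ->
  exists N : nat, forall x : R, 0 <= x <= 1 ->
    Q [set t | `|t - x| * N.+1%:R < 1].
Proof.
move=> Qsub Qloc.
pose P (N : nat) (x : R) := Q [set t | `|t - x| * N.+1%:R < 1].
have := (compact_near_coveringP _).1 (@segment_compact R 0 1) nat \oo P _.
case=> [x x01|N _ NP].
  have [|e e0 Qe] := Qloc x; first by move: x01; rewrite /= in_itv.
  (* Half of the radius at [x] goes to the distance from [x] to [y], half to the window around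
     [y]. *)
  have e20 : 0 < e / 2 by lra.
  exists ([set y | `|x - y| < e / 2], [set N | N.+1%:R^-1 < e / 2]).
    split=> /=.
      by exists (e / 2) => //= y; rewrite /ball_.
    exact: (near_infty_natSinv_lt (PosNum e20)).
  move=> [y N] /= [xy Ne]; apply: Qsub Qe => t /=.
  rewrite -ltr_pdivlMr ?ltr0n // mul1r => ty.
  have {}ty := lt_trans ty Ne.
  have -> : t - x = (t - y) - (x - y) by ring.
  have := ler_normB (t - y) (x - y); lra.
by exists N => x x01; apply: (NP N) => //=.
Qed.

Section polygon.
Context {R : realType} {V : finType} (K : simplicial_complex V).
Local Notation I := (unit_itv R).
Local Notation X := (realization R K).
Implicit Types (M : nat) (x : R).

Definition tent (r : R) : R := Num.max 0 (1 - `|r|).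

Lemma tent_continuous : continuous tent.
Proof.
have cn : continuous (fun r : R => `|r|) by exact: norm_continuous.
by rewrite /tent; solve_continuous.
Qed.

(** Between [k] and [k + 1] only the tents at these two numbers are nonzero, so tent sums
    interpolate linearly. *)
Lemma tent_sum M k (f : nat -> R) x : (k < M)%N -> k%:R <= x <= k.+1%:R ->
  \sum_(j < M.+1) f j * tent (x - j%:R) =
  (1 - (x - k%:R)) * f k + (x - k%:R) * f k.+1.
Proof.
move=> kM /andP[kx xk].
have kM1 : (k < M.+1)%N by exact: ltnW.
rewrite (bigD1 (Ordinal kM1)) //= (bigD1 (Ordinal (kM : k.+1 < M.+1)%N)) /=; last first.
  by apply/eqP => /(congr1 val) /= /eqP; rewrite eqn_leq ltnn.
rewrite -natr1 in xk *.
rewrite big1 ?addr0; last first.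
  move=> j /andP[jk jk1]; rewrite /tent (max_idPl _) ?mulr0 //.
  have {}jk : (j : nat) != k by [].
  have {}jk1 : (j : nat) != k.+1 by [].
  have [jk2|jk2] := ltnP j k.
    have : j.+1%:R <= k%:R :> R by rewrite ler_nat.
    rewrite -natr1 => jk3; rewrite ger0_norm; lra.
  have : k.+2%:R <= j%:R :> R.
    by rewrite ler_nat ltn_neqAle eq_sym jk1 ltn_neqAle eq_sym jk.
  rewrite -!natr1 => jk3; rewrite ler0_norm; lra.
rewrite /tent ger0_norm ?subr_ge0 // (max_idPr _); last by lra.
rewrite ler0_norm; last by lra.
by rewrite (max_idPr _); [ring|lra].
Qed.

Lemma nat_itv M x : (0 < M)%N -> 0 <= x <= M%:R ->
  exists2 k, (k < M)%N & k%:R <= x <= k.+1%:R.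
Proof.
case: M => // M _; elim: M => [|M IH] xM; first by exists 0.
have [x1|x1] := lerP x M.+1%:R.
  have [|k kM kx] := IH; first by rewrite x1 andbT; case/andP: xM.
  by exists k => //; exact: ltnW.
by exists M.+1 => //; rewrite (ltW x1); case/andP: xM.
Qed.

(** A single formula for the edge path through [v 0, ..., v M], which makes continuity immediate
    without gluing. *)
Definition polygon M (v : nat -> V) x : V -> R :=
  fun u => \sum_(j < M.+1) dirac (v j) u * tent (x - j%:R).

Lemma polygonE M v k x : (k < M)%N -> k%:R <= x <= k.+1%:R ->
  polygon M v x = mix (dirac (v k)) (dirac (v k.+1)) (x - k%:R).
Proof.
move=> kM kx; apply/funext => u.
by rewrite /polygon (tent_sum (fun j => dirac (v j) u) kM kx).
Qed.

Lemma polygon_realization M v x : (0 < M)%N -> 0 <= x <= M%:R ->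
  (forall k, (k < M)%N -> adj K (v k) (v k.+1)) ->
  realization R K (polygon M v x : {ptws V -> R}).
Proof.
move=> M0 xM vK; have [k kM kx] := nat_itv M0 xM.
rewrite (polygonE _ kM kx).
apply: (mix_realization (vK k kM)); try exact: dirac_sum.
- by move: kx; rewrite -natr1; lra.
- by move=> u; rewrite /dirac ler0n.
- by move=> u; rewrite /dirac ler0n.
- by move=> u; rewrite /dirac !inE; case: (u == v k); rewrite ?eqxx.
- by move=> u; rewrite /dirac !inE; case: (u == v k.+1); rewrite ?orbT ?eqxx.
Qed.

Lemma polygon_continuous (T : topologicalType) (f : T -> R) M v u :
  continuous f -> continuous (fun t => polygon M v (f t) u).
Proof.
move=> cf; apply: sum_continuous => j.
by apply: mulr_continuous; [|apply: (comp_continuous tent_continuous)];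
  solve_continuous.
Qed.

(** [v k \in supp x] says that [x] lies in the open star of [v k]. *)
Lemma path_star_cover (g : I -> X) : continuous g ->
  exists N v, forall k (t : I), (k <= N.+1)%N ->
    `|N.+1%:R * uval t - k%:R| < 1 -> v k \in supp (g t).
Proof.
move=> cg; pose Q (A : set R) := exists v, forall t, A t -> v \in supp (g (clamp t)).
have [|x x01|N NQ] := @lebesgue_number R Q.
- by move=> A B AB [v Bv]; exists v => t /AB; exact: Bv.
- have [v] := supp_neq0 (g (clamp x)).
  rewrite inE => vx; have gv : 0 < bc (g (clamp x)) v.
    by rewrite lt_neqAle eq_sym vx bc_ge0.
  have cf : continuous (fun t => bc (g (clamp t)) v).
    apply: (comp_continuous (g := bc ^~ v)); first exact: bc_continuous.
    exact: (comp_continuous cg clamp_continuous).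
  have : nbhs x [set t | 0 < bc (g (clamp t)) v].
    apply: open_nbhs_nbhs; split=> //.
    by apply: (@open_comp _ _ (fun t => bc (g (clamp t)) v) [set r | 0 < r]) => //;
      exact: open_gt.
  case=> e /= e0 xe; exists e => //; exists v => t /= tx.
  by rewrite inE gt_eqF //; apply: xe; rewrite /= distrC.
have /choice [v vP] : forall k, exists v, (k <= N.+1)%N ->
    forall t, `|t - k%:R / N.+1%:R| * N.+1%:R < 1 -> v \in supp (g (clamp t)).
  move=> k; have [kN|kN] := leqP k N.+1; last first.
    by have [v _] := supp_neq0 (g zero); exists v.
  have [|v vP] := NQ (k%:R / N.+1%:R); last by exists v.
  by rewrite divr_ge0 //= ler_pdivrMr ?ltr0n // mul1r ler_nat.
exists N, v => k t kN tk; rewrite -[t]uvalK; apply: vP => //.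
rewrite -[X in _ * X]ger0_norm // -normrM mulrBl divfK ?pnatr_eq0 //.
by rewrite mulrC.
Qed.

End polygon.

(** * Realizing loops at a configuration inside one edge *)

Section full_line.
Context {R : realType} {V : finType} (K : simplicial_complex V).
Local Notation I := (unit_itv R).
Local Notation X := (realization R K).
Variables (o : X) (w u1 u2 u3 : V).
Hypotheses (f12 : fork K w u1 u2) (f32 : fork K w u3 u2) (u13 : u1 != u3).
Variables (n : nat) (s : 'I_n -> R).
Hypotheses (s_inj : injective s) (s01 : forall j, 0 < s j < 1).
Local Notation Z := {ptws 'I_n -> X}.
Local Notation F := (config_space X n).
Local Notation line := (line o w u1 u2).

Let c : Z := fun j => line (s j).

Let Fc : F c.
Proof.
move=> i j ij /(line_inj f12) => /(_ _ _)/s_inj H.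
by move/eqP: ij; apply; apply: H; [have := s01 i|have := s01 j]; lra.
Qed.

Let wK : [set w]%SET \in K.
Proof. by case: f12 => _ _ _ wu _; exact: (@adj_vertex _ K w u1). Qed.

Let u1K : [set u1]%SET \in K.
Proof.
by case: f12 => _ _ _ wu _; apply: (@adj_vertex _ K u1 w); rewrite adj_sym.
Qed.

Lemma line_edge (r : R) : 0 <= r <= 1 ->
  line r = seg o (vertex o w) (vertex o u1) r.
Proof.
move=> r01; have [_ _ _ wu _] := f12; apply: bc_inj => v.
rewrite bc_line //; last by lra.
rewrite bc_seg //; last by rewrite /joinable !supp_vertexE.
rewrite !bc_vertex // /lineg (max_idPr _); last lra.
by rewrite (max_idPl _); [ring|lra].
Qed.

Lemma line0 : line 0 = vertex o w.
Proof. by rewrite line_edge ?seg0 // lexx ler01. Qed.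

(** The given path may run through other points. It stays in the star of [w], so the collision-free
    path of [line_swap] can replace it. *)
Lemma deformable_on_line k (f : I -> R) : continuous f ->
  (forall t, 0 <= f t <= 1) ->
  (forall j, j != k -> s j <> f zero) -> (forall j, j != k -> s j <> f one) ->
  deformable F (fun t => upd c k (line (f t)) : Z).
Proof.
move=> cf f01 f0 f1; apply: (deformable_star o (w := w)).
- by apply: upd_cts; apply: line_continuous => // t; have := f01 t; lra.
- move=> t j; rewrite /upd; case: eqP => _; apply: line_cstar => //.
    by have := f01 t; lra.
  by have := s01 j; lra.
have updL r : upd c k (line r) = fun j => line (upd s k r j).
  by apply/funext => j; rewrite /upd; case: eqP.
rewrite !updL (_ : upd s k (f one) = upd (upd s k (f zero)) k (f one)).
  apply: (@line_swap _ _ _ o _ _ _ _ f12 f32 u13 n (upd s k (f zero)) k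
    (f one)) => //.
  - move=> i j; rewrite /upd.
    have [->|ik] := eqVneq i k; have [->|jk] := eqVneq j k => //.
    + by move=> /esym /f0 => /(_ jk).
    + by move=> /f0 => /(_ ik).
    + exact: s_inj.
  - by move=> j; rewrite /upd; case: eqP => // _; have := s01 j; lra.
  - by move=> j jk; rewrite updN //; exact: f1.
by apply/funext => j; rewrite /upd; case: eqP.
Qed.

Lemma deformable_along_edge k (a b : V) : adj K a b ->
  deformable F
    (fun t : I => upd c k (seg o (vertex o a) (vertex o b) (uval t)) : Z).
Proof.
move=> ab; have aK := adj_vertex ab.
have bK : [set b]%SET \in K by apply: (@adj_vertex _ K b a); rewrite adj_sym.
have abK : joinable (vertex o a) (vertex o b).
  by rewrite /joinable !supp_vertexE.
have s_out (r : R) j : r = 0 \/ r = 1 -> s j <> r.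
  by move=> r01; have := s01 j => sj rj; case: r01; lra.
have [abE|abE] := pselect ((a = w /\ b = u1) \/ (a = u1 /\ b = w)).
  have [f [cf f01 f0 f1 fE]] : exists f : I -> R, [/\ continuous f,
      forall t, 0 <= f t <= 1, f zero = 0 \/ f zero = 1,
      f one = 0 \/ f one = 1 &
      forall t, seg o (vertex o a) (vertex o b) (uval t) = line (f t)].
    case: abE => -[-> ->].
      exists uval; split; rewrite ?uval_zero ?uval_one; [|exact: uval01|by left|by right|].
        exact: uval_continuous.
      by move=> t; rewrite line_edge //; exact: uval01.
    exists (fun t => 1 - uval t); split; rewrite ?uval_zero ?uval_one.
    - by solve_continuous.
    - by move=> t; have := uval01 t; lra.
    - by right; rewrite subr0.
    - by left; rewrite subrr.
    - move=> t; rewrite line_edge; last by have := uval01 t; lra.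
      have [_ _ _ wu _] := f12.
      apply: bc_inj => v; rewrite !bc_seg; [ring| | | |].
      + by rewrite /joinable !supp_vertexE.
      + by have := uval01 t; lra.
      + by rewrite /joinable !supp_vertexE // finset.setUC.
      + exact: uval01.
  rewrite (_ : (fun t => _) = fun t => upd c k (line (f t)) : Z).
    by apply: deformable_on_line => // j _; exact: s_out.
  by apply/funext => t; rewrite fE.
apply: deformable_id.
  apply: upd_cts; apply: seg_continuous; try exact: cstr_continuous.
  - exact: uval_continuous.
  - by [].
  - exact: uval01.
(* A point of the configuration has support [{w, u1}]; if it lies on the edge from [a] to [b], this
   must be the excluded edge. *)
move=> t; apply: upd_config => // j _ cE; apply: abE.
have sj := s01 j; have t01 := uval01 t.
have supE v : bc (line (s j)) v != 0 -> v = a \/ v = b.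
  rewrite -/(c j) cE bc_seg // !bc_vertex // /dirac.
  case: (v =P a) => [|_]; first by left.
  case: (v =P b) => [|_]; first by right.
  by rewrite !mulr0 addr0 eqxx.
have wu : w <> u1 by case: f12 => _ /eqP.
have wab : w = a \/ w = b.
  apply: supE; rewrite bc_line //; last by lra.
  have [_ wu1 wu2 _ _] := f12; rewrite /lineg /dirac eqxx.
  rewrite (negbTE wu1) (negbTE wu2) (max_idPr _); last lra.
  by rewrite (max_idPl _); [apply/eqP => /=; lra|lra].
have uab : u1 = a \/ u1 = b.
  apply: supE; rewrite bc_line_pos //; last by lra.
  by rewrite (max_idPr _); [apply/eqP; lra|lra].
case: wab => wE; case: uab => uE; try by case: wu; rewrite wE uE.
- by left.
- by right.
Qed.

(** Simplicial approximation: at each time the support of the polygon [h] is inside that of [g], so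
    straight segments deform [g] into [h], whose pieces run along single edges. *)
Lemma deformable_vertex_loop k (g : I -> X) : continuous g ->
  g zero = vertex o w -> g one = vertex o w ->
  deformable F (fun t => upd c k (g t) : Z).
Proof.
move=> cg g0 g1; have [N [v vP]] := path_star_cover cg.
have NR : 0 < N.+1%:R :> R by rewrite ltr0n.
have vK m : (m < N.+1)%N -> adj K (v m) (v m.+1).
  (* Halfway between two subdivision points both chosen vertices are in the support, hence
     adjacent. *)
  move=> mN; pose t : I := clamp ((m%:R + 2^-1) / N.+1%:R).
  have tE : N.+1%:R * uval t = m%:R + 2^-1.
    have m0 : 0 <= m%:R :> R by rewrite ler0n.
    have mN' : m.+1%:R <= N.+1%:R :> R by rewrite ler_nat.
    rewrite uval_clamp_id ?[RHS]mulrC; first by rewrite mulrCA divff ?mulr1 ?lt0r_neq0.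
      by rewrite divr_ge0 ?(ltW NR) //; lra.
    by rewrite ler_pdivrMr // mul1r; rewrite -natr1 in mN'; lra.
  apply: (simplex_adj (supp_simplex (g t))); apply: vP; rewrite ?tE ?(ltnW mN) //.
    by rewrite addrAC subrr add0r ger0_norm; lra.
  by rewrite -(natr1 m) ler0_norm; lra.
pose h (t : I) : X := pt o (polygon N.+1 v (N.+1%:R * uval t)).
have t0N (t : I) : 0 <= N.+1%:R * uval t <= N.+1%:R.
  by rewrite mulr_ge0 ?uval_ge0 ?(ltW NR) //= ler_piMr ?uval_le1 ?(ltW NR).
have hK (t : I) := @polygon_realization _ _ K N.+1 v _ isT (t0N t) vK.
have ch : continuous h.
  apply: pt_continuous => // u; apply: polygon_continuous; solve_continuous.
have hsupp t : supp (h t) \subset supp (g t).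
  apply/fintype.subsetP => u; rewrite [u \in supp (h t)]inE => hu; apply: contraNT hu => gu.
  rewrite /h bc_pt // /polygon big1 // => j _.
  have [uj|uj] := eqVneq u (v j); last by rewrite /dirac (negbTE uj) mul0r.
  rewrite /tent (max_idPl _) ?mulr0 //.
  have := vP j t; rewrite -uj (negbTE gu) -ltnS ltn_ord => /(_ isT).
  by move=> H; rewrite subr_le0 leNgt; apply/negP => /H.
have ghK t : joinable (g t) (h t).
  by rewrite /joinable (finset.setUidPl (hsupp t)) supp_simplex.
(* At the ends the support of [g] is [{w}], which forces [h] to be at [w] too; so the homotopy fixes
   the ends. *)
have h_w t : g t = vertex o w -> h t = vertex o w.
  move=> gw; have sh : supp (h t) = [set w]%SET.
    have := hsupp t; rewrite gw supp_vertexE // subset1 => /orP[/eqP//|].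
    by rewrite (negbTE (simplex_neq0 (supp_simplex _))).
  have hv v0 : v0 != w -> bc (h t) v0 = 0.
    move=> v0w; apply/eqP/negPn/negP => hv0.
    have : v0 \in supp (h t) by rewrite inE.
    by rewrite sh inE (negbTE v0w).
  apply: bc_inj => v0; rewrite bc_vertex // /dirac.
  have [->|/hv //] := eqVneq v0 w.
  by rewrite -(bc_sum (h t)) (bigD1 w) //= big1 ?addr0.
apply: (deformable_homotopic (q := fun t => upd c k (h t) : Z)).
  exists (fun st => upd c k (seg o (g st.1) (h st.1) (uval st.2)) : Z).
  split=> [|t|t|t|t] /=.
  - apply: upd_cts; apply: seg_continuous => //; try solve_continuous.
    by move=> t; exact: uval01.
  - by rewrite uval_zero seg0.
  - by rewrite uval_one seg1.
  - rewrite (h_w _ g0) g0; congr upd; apply: pt_bc => v0.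
    by rewrite /mix; ring.
  - rewrite (h_w _ g1) g1; congr upd; apply: pt_bc => v0.
    by rewrite /mix; ring.
apply: (deformable_subdivide (N := N)); first exact: upd_cts.
move=> m mN.
rewrite (_ : subpath _ _ _ = fun t : I =>
  upd c k (seg o (vertex o (v m)) (vertex o (v m.+1)) (uval t)) : Z).
  exact/deformable_along_edge/vK.
apply/funext => t; rewrite /subpath; congr upd; rewrite /h.
have mK := adj_vertex (vK m mN).
have m1K : [set (v m.+1)]%SET \in K.
  by apply: (@adj_vertex _ K _ (v m)); rewrite adj_sym; exact: vK.
have m0 : 0 <= m%:R :> R by rewrite ler0n.
have mN' : m.+1%:R <= N.+1%:R :> R by rewrite ler_nat.
have [t0 t1] : 0 <= uval t /\ uval t <= 1 by split; [exact: uval_ge0|exact: uval_le1].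
have NE : N.+1%:R * uval (clamp (m%:R / N.+1%:R +
    (m.+1%:R / N.+1%:R - m%:R / N.+1%:R) * uval t)) = m%:R + uval t.
  rewrite -(natr1 m) in mN' *.
  have -> : m%:R / N.+1%:R + ((m%:R + 1) / N.+1%:R - m%:R / N.+1%:R) * uval t =
      (m%:R + uval t) / N.+1%:R by field; exact: lt0r_neq0.
  rewrite uval_clamp_id; first by rewrite mulrC divfK // lt0r_neq0.
    by rewrite divr_ge0 ?(ltW NR) //; lra.
  by rewrite ler_pdivrMr // mul1r; lra.
rewrite NE (polygonE _ mN); last by rewrite -(natr1 m); lra.
apply: pt_bc => v0; rewrite /mix bc_seg; [|by rewrite /joinable !supp_vertexE//; exact: vK|exact: uval01].
by rewrite !bc_vertex // addrAC subrr add0r.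
Qed.

Lemma full_line : full R c.
Proof.
apply: full_coordinatewise => k g cg g0 g1.
have sk := s01 k.
pose a (t : I) : X := line (s k * uval t).
have sk01 (t : I) : 0 <= s k * uval t <= 1.
  by have := uval_ge0 t; have := uval_le1 t; nra.
have ca : continuous a.
  apply: line_continuous => //; first by solve_continuous.
  by move=> t; have := sk01 t; lra.
have a0 : a zero = vertex o w by rewrite /a uval_zero mulr0 line0.
have a1 : a one = c k by rewrite /a uval_one mulr1.
have cia : continuous (path_inv a).
  by apply: (comp_continuous ca); solve_continuous.
have ia0 : path_inv a zero = c k by rewrite /path_inv uval_zero subr0.
have ia1 : path_inv a one = vertex o w by rewrite /path_inv uval_one subrr.
have cg' : continuous (path_cat g (path_inv a)).
  by apply: path_cat_cts => //; rewrite g1 ia0.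
(* The loop [g] at [c k] is conjugated to a loop at [w] along the edge. *)
pose d := path_cat a (path_cat g (path_inv a)).
have cd : continuous d.
  by apply: path_cat_cts => //; rewrite a1 path_cat_zeroE g0.
have d0 : d zero = vertex o w by rewrite /d path_cat_zeroE.
have d1 : d one = vertex o w by rewrite /d !path_cat_oneE.
have dd := deformable_vertex_loop k cd d0 d1.
pose p (t : I) : Z := upd c k (d t).
have cp : continuous p by exact: upd_cts.
have -> : (fun t => upd c k (g t) : Z) = subpath p 2^-1 (3/4).
  apply/funext => t; rewrite /subpath /p; congr upd.
  have t0 := uval_ge0 t; have t1 := uval_le1 t.
  rewrite /d path_cat_clamp; [|lra|lra].
  case: ifP => [t2|_].
    have -> : t = zero by apply: uval_inj; rewrite uval_zero; lra.
    by rewrite g0 -a1 uval_zero mulr0 addr0 divff.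
  rewrite path_cat_clamp; [|lra|lra].
  rewrite ifT; last lra.
  by rewrite -[in LHS](uvalK t); congr (g (clamp _)); lra.
have in01 (x : R) : 0 <= x -> x <= 1 -> 0 <= x <= 1 by move=> -> ->.
have sN j (x : R) : j != k -> x = s k \/ x = 0 -> s j <> x.
  move=> jk [->|->]; first by move/s_inj => jk'; rewrite jk' eqxx in jk.
  by have := s01 j; lra.
(* The device of [full_conn] again; here the outer pieces run inside the edge and are handled by
   [deformable_on_line]. *)
apply: (@deformable_subpath_trans _ _ _ _ _ 1) => //; try by apply: in01; lra.
  apply: (@deformable_subpath_trans _ _ _ _ _ 0) => //;
    try by apply: in01; lra.
    rewrite (_ : subpath _ _ _ =
        fun t => upd c k (line (s k * (1 - uval t))) : Z).
      apply: deformable_on_line; first by solve_continuous.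
      - by move=> t; have := uval_ge0 t; have := uval_le1 t; nra.
      - by move=> j jk; apply: sN => //; left; rewrite uval_zero subr0 mulr1.
      - by move=> j jk; apply: sN => //; right; rewrite uval_one subrr mulr0.
    apply/funext => t; rewrite /subpath /p; congr upd.
    have t0 := uval_ge0 t; have t1 := uval_le1 t.
    rewrite /d path_cat_clamp; [|lra|lra].
    rewrite ifT; last by lra.
    by rewrite /a uval_clamp_id; [congr line; lra|lra|lra].
  by rewrite subpath01.
rewrite (_ : subpath _ _ _ = fun t => upd c k (line (s k * uval t)) : Z).
  apply: deformable_on_line; first by solve_continuous.
  - by [].
  - by move=> j jk; apply: sN => //; right; rewrite uval_zero mulr0.
  - by move=> j jk; apply: sN => //; left; rewrite uval_one mulr1.
apply/funext => t; rewrite /subpath /p; congr upd.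
have t0 := uval_ge0 t; have t1 := uval_le1 t.
rewrite /d path_cat_clamp; [|lra|lra].
rewrite ifF; last by lra.
rewrite path_cat_clamp; [|lra|lra].
case: ifP => [t2|_].
  have tE : uval t = 1 by lra.
  rewrite (_ : clamp _ = one); last by apply: clamp_ge1; lra.
  by rewrite g1 tE mulr1.
rewrite /path_inv /a [uval (clamp (2 * _ - 1))]uval_clamp_id; [|lra|lra].
by rewrite uval_clamp_id; [congr line; lra|lra|lra].
Qed.

End full_line.

(** * Contractible spaces and the circle *)

Section contractible.
Context {R : realType} {X : topologicalType} {n : nat}.
Local Notation I := (unit_itv R).

(** Every loop of tuples is null-homotopic, so the constant one replaces it. The contraction may
    move the basepoint, which [homotopic_contract] allows. *)
Lemma full_contract (G : X * I -> X) (z : X) (c : {ptws 'I_n -> X}) :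
  continuous G -> (forall x, G (x, zero) = x) -> (forall x, G (x, one) = z) ->
  config_space X n c -> full R c.
Proof.
move=> cG G0 G1 Fc p cp p0 p1.
apply: (deformable_homotopic (q := fun=> c)); last first.
  by apply: deformable_id => //; exact: cstr_continuous.
pose H (q : I -> {ptws 'I_n -> X}) (st : I * I) : {ptws 'I_n -> X} :=
  fun j => G (q st.1 j, st.2).
have cH q : continuous q -> continuous (H q).
  move=> cq; apply: continuous_ptws => j; apply: (comp_continuous cG).
  apply: continuous_pair; last exact: continuous_snd.
  apply: (comp_continuous (g := fun t => q t j)); last exact: continuous_fst.
  exact: ptws_proj_continuous.
apply: (@homotopic_contract _ _ p (fun=> c) (fun=> z) (H p) (H (fun=> c))).
- exact: cH.
- by apply: cH; exact: cstr_continuous.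
- by move=> t; apply/funext => j; rewrite /H G0.
- by move=> t; apply/funext => j; rewrite /H G0.
- by move=> t; apply/funext => j; rewrite /H G1.
- by move=> t; apply/funext => j; rewrite /H G1.
- by move=> t; rewrite /H /= p0.
- by move=> t; rewrite /H /= p1.
Qed.

End contractible.

Lemma hausdorff_injective (T Y : topologicalType) (f : T -> Y) :
  continuous f -> injective f -> hausdorff_space Y -> hausdorff_space T.
Proof.
move=> cf f_inj hY x y xy; apply/f_inj/hY => A B fA fB.
have [z [Az Bz]] := xy _ _ (cf x A fA) (cf y B fB).
by exists (f z).
Qed.

(** Maps from a compact space to Hausdorff spaces are closed, so [Y] and [Z] are quotients of [T],
    by the same relation. *)
Lemma quotient_homeomorphic (T Y Z : topologicalType) (f : T -> Y)
    (g : T -> Z) :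
  compact [set: T] -> hausdorff_space Y -> hausdorff_space Z ->
  continuous f -> continuous g ->
  (forall y, exists t, f t = y) -> (forall z, exists t, g t = z) ->
  (forall a b, f a = f b <-> g a = g b) -> homeomorphic Y Z.
Proof.
move=> cT hY hZ cf cg fsurj gsurj fg.
have [rf rfK] := choice fsurj; have [rg rgK] := choice gsurj.
have key (A B : topologicalType) (h : T -> A) (k : T -> B) (rh : A -> T) :
    hausdorff_space A -> continuous h -> continuous k ->
    (forall a, h (rh a) = a) -> (forall a b, h a = h b -> k a = k b) ->
    continuous (k \o rh).
  move=> hA ch ck rhK hk; apply/continuous_closedP => C cC.
  rewrite (_ : _ @^-1` _ = h @` (k @^-1` C)); last first.
    apply/seteqP; split=> [a /= Ca|_ [t Ct <-]].
      by exists (rh a).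
    by rewrite /= (hk (rh (h t)) t).
  apply: compact_closed => //; apply: continuous_compact.
    exact: continuous_subspaceT.
  apply: (subclosed_compact _ cT) => //.
  by apply: closed_comp => // t _; exact: ck.
exists (g \o rf), (f \o rg); split.
- by apply: key rfK _ => // a b /fg.
- by apply: key rgK _ => // a b /fg.
- by move=> y /=; rewrite -[RHS]rfK; apply/fg.
- by move=> z /=; rewrite -[RHS]rgK; apply/fg.
Qed.

Lemma unit_itv_compact (R : realType) : compact [set: unit_itv R].
Proof.
rewrite (_ : [set: _] = clamp @` `[0, 1]%classic).
  apply: continuous_compact; last exact: segment_compact.
  exact/continuous_subspaceT/clamp_continuous.
apply/seteqP; split=> // t _; exists (uval t); last exact: uvalK.
by rewrite /= in_itv /= uval_ge0 uval_le1.
Qed.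

Section circle.
Context {R : realType}.
Local Notation I := (unit_itv R).
Implicit Types (x y a b : R).

(** The half-angle formula gives [sin (x / 2) = 0], while the sine is positive strictly between 0
    and [pi]. *)
Lemma cos_eq1 x : `|x| < pi *+ 2 -> cos x = 1 -> x = 0.
Proof.
wlog x0 : x / 0 <= x => [H xpi cx|].
  have [x0|x0] := lerP 0 x; first exact: H.
  apply/eqP; rewrite -oppr_eq0; apply/eqP; apply: H; rewrite ?normrN ?cosN //.
  by rewrite oppr_ge0 ltW.
rewrite ger0_norm // => xpi cx.
have : sin (x / 2) ^+ 2 = 0.
  rewrite sin2cos2; have := cos_mulr2n (x / 2).
  by rewrite -[_ *+ 2]mulr_natr divfK // cx; lra.
move/eqP; rewrite sqrf_eq0 => /eqP sx.
apply: contrapT => /eqP xn0; have : 0 < sin (x / 2).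
  have {}x0 : 0 < x by rewrite lt_neqAle eq_sym xn0.
  by apply: sin_gt0_pi; rewrite divr_gt0 //= ltr_pdivrMr // mulr_natr.
by rewrite sx ltxx.
Qed.

Lemma cos_sin_inj x y : `|x - y| < pi *+ 2 ->
  cos x = cos y -> sin x = sin y -> x = y.
Proof.
move=> xy cxy sxy; apply/eqP; rewrite -subr_eq0; apply/eqP/cos_eq1 => //.
by rewrite cosB cxy sxy -!expr2 cos2Dsin2.
Qed.

Lemma cos_sin_surj x y : x ^+ 2 + y ^+ 2 = 1 ->
  exists2 a, 0 <= a <= pi *+ 2 & cos a = x /\ sin a = y.
Proof.
move=> xy1; have x1 : -1 <= x <= 1 by apply/andP; split; nra.
have sa : sin (acos x) = `|y|.
  by rewrite sin_acos // -sqrtr_sqr; congr Num.sqrt; rewrite -xy1; ring.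
have ca : cos (acos x) = x by rewrite acosK // in_itv.
have pi0 : 0 < pi :> R := pi_gt0 R.
have a0 := acos_ge0 x1; have a1 := acos_lepi x1.
have [y0|y0] := lerP 0 y.
  exists (acos x); first by rewrite a0 /= mulr2n; lra.
  by rewrite sa ger0_norm.
exists (pi *+ 2 - acos x); first by rewrite mulr2n; lra.
rewrite cosB sinB cos2pi sin2pi ca sa ltr0_norm //.
by rewrite !mul1r !mul0r addr0 sub0r opprK.
Qed.

Definition turn (t : R) : R * R :=
  (cos (pi *+ 2 * t), sin (pi *+ 2 * t)).

Lemma turn_circle t : circle R (turn t).
Proof. exact: cos2Dsin2. Qed.

Lemma turn_continuous : continuous turn.
Proof.
have cm : continuous (fun t : R => pi *+ 2 * t).
  by apply: mulr_continuous; [exact: cstr_continuous|move=> t; exact: cvg_id].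
apply: continuous_pair.
  exact: (comp_continuous (@continuous_cos R) cm).
exact: (comp_continuous (@continuous_sin R) cm).
Qed.

Definition circle_param (t : I) : circle R :=
  SigSub (mem_set (turn_circle (uval t))).

Lemma circle_param_continuous : continuous circle_param.
Proof.
apply: continuous_set_type.
exact: (comp_continuous turn_continuous uval_continuous).
Qed.

Lemma circle_param_surj z : exists t, circle_param t = z.
Proof.
have [a a01 [ca sa]] := cos_sin_surj (set_valP z).
have pi0 : 0 < pi *+ 2 :> R by rewrite pmulrn_lgt0 // pi_gt0.
exists (clamp (a / (pi *+ 2))); apply: val_inj; rewrite /= /turn.
have [a0 a1] := andP a01.
rewrite uval_clamp_id ?divr_ge0 // ?(ltW pi0) // ?ler_pdivrMr ?mul1r //.
by rewrite mulrC divfK ?lt0r_neq0 // ca sa -surjective_pairing.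
Qed.

Lemma circle_param_eq s t : circle_param s = circle_param t <->
  [\/ s = t, s = zero /\ t = one | s = one /\ t = zero].
Proof.
have t01 : turn 0 = turn 1.
  by rewrite /turn mulr0 mulr1 cos0 sin0 cos2pi sin2pi.
split=> [|[->//|[-> ->]|[-> ->]]]; last 2 first.
- by apply: val_inj; rewrite /= uval_zero uval_one.
- by apply: val_inj; rewrite /= uval_zero uval_one.
move=> /(congr1 set_val) [] cst sst.
have [st|st] := ltP `|uval s - uval t| 1.
  constructor 1; apply: uval_inj.
  have pi0 : 0 < pi *+ 2 :> R by rewrite pmulrn_lgt0 // pi_gt0.
  have := cos_sin_inj _ cst sst; rewrite -mulrBr normrM gtr0_norm //.
  rewrite gtr_pMr // => /(_ st); apply: mulfI.
  exact: lt0r_neq0.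
have s0 := uval_ge0 s; have s1 := uval_le1 s.
have t0 := uval_ge0 t; have t1 := uval_le1 t.
have [le|lt] := lerP (uval s) (uval t).
  rewrite ler0_norm in st; last by lra.
  by constructor 2; split; apply: uval_inj; rewrite ?uval_zero ?uval_one; lra.
rewrite gtr0_norm in st; last by lra.
by constructor 3; split; apply: uval_inj; rewrite ?uval_zero ?uval_one; lra.
Qed.

Lemma circle_hausdorff : hausdorff_space (circle R).
Proof.
apply: (@hausdorff_injective _ (R * R)%type set_val); last exact: norm_hausdorff.
- exact: set_val_continuous.
- exact: val_inj.
Qed.

End circle.

(** * Strands on the circle *)

Section winding.
Context {R : realType}.
Local Notation I := (unit_itv R).
Implicit Types (p q : I -> R * R).

(** For a loop on the circle: winding number zero. *)
Definition closed_lift p := exists a : I -> R,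
  [/\ continuous a, a zero = a one & forall s, p s = (cos (a s), sin (a s))].

(** The quotient [p / q] avoids [1], so it has the argument
    [pi - 2 atan (y / (1 - x))]. *)
Lemma closed_lift_avoid p q : continuous p -> continuous q ->
  (forall s, circle R (p s)) -> p zero = p one -> q zero = q one ->
  (forall s, p s <> q s) -> closed_lift q -> closed_lift p.
Proof.
move=> cp cq Cp p01 q01 pq [a [ca a01 qE]].
(* [x + i y] is [p] times the complex conjugate of [q]. *)
pose x s := (p s).1 * (q s).1 + (p s).2 * (q s).2.
pose y s := (p s).2 * (q s).1 - (p s).1 * (q s).2.
have Cq s : (q s).1 ^+ 2 + (q s).2 ^+ 2 = 1 by rewrite qE /= cos2Dsin2.
have xy1 s : x s ^+ 2 + y s ^+ 2 = 1.
  transitivity (((p s).1 ^+ 2 + (p s).2 ^+ 2) * ((q s).1 ^+ 2 + (q s).2 ^+ 2)).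
    by rewrite /x /y; ring.
  by rewrite Cq mulr1; exact: Cp.
have pE s : p s = ((q s).1 * x s - (q s).2 * y s, (q s).1 * y s + (q s).2 * x s).
  rewrite [LHS]surjective_pairing; congr pair.
    by rewrite -[LHS]mulr1 -(Cq s) /x /y; ring.
  by rewrite -[LHS]mulr1 -(Cq s) /x /y; ring.
have x1 s : 0 < 1 - x s.
  rewrite subr_gt0 lt_neqAle; apply/andP; split; last by have := xy1 s; nra.
  apply/eqP => xs; apply: (pq s); rewrite pE xs.
  have ys : y s = 0 by have := xy1 s; rewrite xs; nra.
  by rewrite ys !mulr0 !mulr1 subr0 add0r -surjective_pairing.
have cx : continuous x by rewrite /x; solve_continuous.
have cy : continuous y by rewrite /y; solve_continuous.
pose c s := y s / (1 - x s).
have cc : continuous c.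
  have cx1 : continuous (fun s => 1 - x s) by solve_continuous.
  apply: (mulr_continuous cy) => s.
  by apply: (continuousV (s := fun s => 1 - x s)) (cx1 s); exact: lt0r_neq0.
pose b s := pi - (atan (c s) + atan (c s)).
have cb : continuous b.
  have cac : continuous (fun s => atan (c s)).
    by apply: (comp_continuous (g := @atan R)) cc => r; exact: continuous_atan.
  by rewrite /b; solve_continuous.
have bE s : cos (b s) = x s /\ sin (b s) = y s.
  have cn : cos (atan (c s)) != 0.
    rewrite cos_atan invr_eq0 sqrtr_eq0 -ltNge.
    by rewrite ltr_wpDr // sqr_ge0.
  (* The squared cosine is [1 / (1 + c^2)], and [1 + c^2 = 2 / (1 - x)] because [x^2 + y^2 = 1]. *)
  have c2 : cos (atan (c s)) ^+ 2 = (1 - x s) / 2.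
    have := cos2_tan2 cn; rewrite atanK => h.
    rewrite -[LHS]invrK h.
    have -> : 1 + c s ^+ 2 = 2 / (1 - x s).
      rewrite /c expr_div_n; have := xy1 s => xy.
      have -> : y s ^+ 2 = 1 - x s ^+ 2 by rewrite -xy; ring.
      by field; exact: lt0r_neq0.
    by rewrite invf_div.
  have sE : sin (atan (c s)) = c s * cos (atan (c s)).
    by rewrite -{2}(atanK (c s)) /tan divfK.
  have cM : c s * (1 - x s) = y s by rewrite /c divfK // lt0r_neq0.
  rewrite /b cosB sinB cospi sinpi cosD sinD sE; split.
    rewrite (_ : _ + _ = - (cos (atan (c s)) ^+ 2) +
      c s ^+ 2 * cos (atan (c s)) ^+ 2); last by ring.
    rewrite c2 /c expr_div_n.
    have -> : y s ^+ 2 = 1 - x s ^+ 2 by rewrite -(xy1 s); ring.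
    by field; exact: lt0r_neq0.
  rewrite (_ : _ - _ = 2 * c s * cos (atan (c s)) ^+ 2); last by ring.
  by rewrite c2 -cM; field.
exists (fun s => a s + b s); split.
- exact: addr_continuous.
- by rewrite a01 /b /c /x /y p01 q01.
- move=> s; have [bc bs] := bE s; rewrite cosD sinD bc bs pE qE /=.
  by congr pair; ring.
Qed.

(** The lift is passed from time one down to time zero through finitely many loops, each so close to
    the next that the next avoids its opposite. *)
Lemma closed_lift_homotopic (H : I * I -> R * R) : continuous H ->
  (forall st, circle R (H st)) -> (forall t, H (zero, t) = H (one, t)) ->
  closed_lift (fun s => H (s, one)) -> closed_lift (fun s => H (s, zero)).
Proof.
move=> cH CH H01.
(* A positive inner product excludes antipodal points. *)
pose dot (s t t' : I) : R :=
  (H (s, t)).1 * (H (s, t')).1 + (H (s, t)).2 * (H (s, t')).2.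
have step (t t' : I) : (forall s, 0 < dot s t t') ->
    closed_lift (fun s => H (s, t)) -> closed_lift (fun s => H (s, t')).
  move=> tt' [a [ca a01 aE]].
  have cHt u : continuous (fun s => H (s, u)).
    by apply: (comp_continuous cH); apply: continuous_pair;
      [move=> s; exact: cvg_id|exact: cstr_continuous].
  have cHt' := cHt t; have cHt'' := cHt t'.
  apply: (@closed_lift_avoid _ (fun s => (- (H (s, t)).1, - (H (s, t)).2))) => //.
  - by solve_continuous.
  - by rewrite H01.
  - move=> s /= Hs; have := tt' s; rewrite /dot Hs /=.
    by have := CH (s, t); rewrite /circle /=; nra.
  - exists (fun s => a s + pi); split.
    + by apply: addr_continuous => //; exact: cstr_continuous.
    + by rewrite a01.
    + by move=> s; rewrite aE /= cosDpi sinDpi.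
pose Q (A : set R) := forall t t', A t -> A t' ->
  forall s, 0 < dot s (clamp t) (clamp t').
have [|x x01|N NQ] := @lebesgue_number R Q.
- by move=> A B AB QB t t' /AB At /AB; exact: QB.
(* Compactness in [s] makes the neighbourhood of the time [x] uniform along the loops. *)
- have := (compact_near_coveringP _).1 (@unit_itv_compact R) _
    (nbhs ((x, x) : R * R))
    (fun tt s => 0 < dot s (clamp tt.1) (clamp tt.2)) _.
  case=> [s _|[A B] /= [xA xB] AB].
    pose f (w : I * (R * R)) := dot w.1 (clamp w.2.1) (clamp w.2.2).
    have cf : continuous f by rewrite /f /dot; solve_continuous.
    apply: (cf (s, (x, x)) [set r | 0 < r]).
    apply: open_nbhs_nbhs; split; first exact: open_gt.
    by rewrite /= /f /dot -!expr2 (CH (s, clamp x)) ltr01.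
  have [e /= e0 eAB] : nbhs x (A `&` B) by exact: filterI.
  exists e => // t t' /= tx t'x s; apply: (AB (t, t')) => //=.
  rewrite distrC in tx; rewrite distrC in t'x.
  by have [At _] := eAB t tx; have [_ Bt'] := eAB t' t'x.
have NR : 0 < N.+1%:R :> R by rewrite ltr0n.
move=> H1.
suff K k : (k <= N.+1)%N ->
    closed_lift (fun s => H (s, clamp (1 - k%:R / N.+1%:R))).
  by have := K N.+1 (leqnn _); rewrite divff ?lt0r_neq0 // subrr.
elim: k => [|k IH] kN; first by rewrite mul0r subr0.
apply: step (IH (ltnW kN)) => s.
have kN' : k.+1%:R <= N.+1%:R :> R by rewrite ler_nat.
have k0 : 0 <= k%:R :> R by rewrite ler0n.
rewrite -(natr1 k) in kN' *.
(* The midpoint of the step: both of its ends are half a mesh away, inside the window. *)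
have xE : 0 <= (1 - (k%:R + 2^-1) / N.+1%:R : R) <= 1.
  have q0 : 0 <= (k%:R + 2^-1) / N.+1%:R :> R by rewrite divr_ge0 ?(ltW NR) //; lra.
  have q1 : (k%:R + 2^-1) / N.+1%:R <= 1 :> R by rewrite ler_pdivrMr // mul1r; lra.
  by rewrite subr_ge0 q1 gerBl q0.
apply: (NQ _ xE) => /=; rewrite -[X in _ * X]gtr0_norm // -normrM.
  rewrite (_ : (_ - _) * _ = 2^-1); last by field; exact: lt0r_neq0.
  by rewrite ger0_norm; lra.
rewrite (_ : (_ - _) * _ = - 2^-1); last by field; exact: lt0r_neq0.
by rewrite normrN ger0_norm; lra.
Qed.

(** Complex multiplication. *)
Definition rotate (z w : R * R) : R * R :=
  (z.1 * w.1 - z.2 * w.2, z.1 * w.2 + z.2 * w.1).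

Lemma rotate_circle z w : circle R z -> circle R w -> circle R (rotate z w).
Proof.
rewrite /circle /= => z1 w1.
transitivity ((z.1 ^+ 2 + z.2 ^+ 2) * (w.1 ^+ 2 + w.2 ^+ 2)); first by ring.
by rewrite z1 w1 mulr1.
Qed.

(** The difference [f] of a closed lift and the standard argument drops by [2 pi], yet its cosine is
    always 1; halfway down the cosine would be -1. *)
Lemma rotate_turn_lift z : circle R z ->
  ~ closed_lift (fun s => rotate z (turn (uval s))).
Proof.
move=> /cos_sin_surj [a _ [az bz]] [b [cb b01 bE]].
pose f (r : R) := b (clamp r) - (a + pi *+ 2 * uval (clamp r : I)).
have cf : continuous f.
  by rewrite /f; solve_continuous.
have pi0 := pi_gt0 R.
have f1 : f 1 = f 0 - pi *+ 2.
  by rewrite /f clamp_zero clamp_one uval_zero uval_one b01; ring.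
have fE r : cos (f r) = 1.
  have := bE (clamp r); rewrite /rotate /turn -az -bz /= => -[cE sE].
  rewrite -cosD in cE; rewrite addrC -sinD in sE.
  by rewrite /f cosB -cE -sE -!expr2 cos2Dsin2.
have [||r _ fr] := @IVT R f 0 1 (f 0 - pi) ler01.
- exact: continuous_subspaceT.
- by rewrite f1 mulr2n ge_min le_max; apply/andP; split; apply/orP; [right|left]; lra.
have := fE r; rewrite fr cosB fE cospi sinpi; lra.
Qed.

Section circle_strands.
Context {X : topologicalType} {n : nat}.
Variables (f : X -> circle R) (g : circle R -> X).
Hypotheses (cf : continuous f) (cg : continuous g).
Hypotheses (fK : cancel f g) (gK : cancel g f).

Let F (x : X) : R * R := set_val (f x).

Let cF : continuous F.
Proof. exact: (comp_continuous (@set_val_continuous _ _) cf). Qed.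

Let FC x : circle R (F x).
Proof. exact: set_valP. Qed.

Let closed_lift_path_homotopic x (p q : I -> X) : path_homotopic x x p q ->
  closed_lift (F \o p) -> closed_lift (F \o q).
Proof.
move=> /path_homotopic_sym [H [cH H0 H1 Hx Hy]] [a [ca a01 aE]].
have [||||b [cb b01 bE]] := @closed_lift_homotopic (F \o H).
- exact: (comp_continuous cF cH).
- by move=> st; exact: FC.
- by move=> t; rewrite /= Hx Hy.
- by exists a; split=> // s; rewrite /= H1; exact: aE.
- by exists b; split=> // s; rewrite -bE /= H0.
Qed.

Lemma circle_strand_map_not_surj (x0 : config_space X n) : (2 <= n)%N ->
  ~ set_surj [set: pure_braid_group R x0] [set: pi1_prod R (config_incl x0)]
    (strand_map R x0).
Proof.
move=> n2 surj.
pose i : 'I_n := Ordinal (ltnW n2); pose j : 'I_n := Ordinal n2.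
pose r l (t : I) : circle R := SigSub (mem_set
  (rotate_circle (FC (config_incl x0 l)) (turn_circle (uval t)))).
have cr l : continuous (g \o r l).
  apply: (comp_continuous cg); apply: continuous_set_type.
  have ct := comp_continuous (@turn_continuous R) (@uval_continuous R).
  by rewrite /= /rotate; apply: continuous_pair; solve_continuous.
have rl l s : turn s = turn 0 -> rotate (F (config_incl x0 l)) (turn s) =
    F (config_incl x0 l).
  move=> ->; rewrite /rotate /turn mulr0 cos0 sin0 /=.
  by rewrite !mulr1 !mulr0 subr0 add0r -surjective_pairing.
have r0 l : (g \o r l) zero = config_incl x0 l.
  rewrite -[RHS]fK /=; congr g; apply: val_inj.
  by rewrite /= uval_zero rl.
have r1 l : (g \o r l) one = config_incl x0 l.
  rewrite -[RHS]fK /=; congr g; apply: val_inj.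
  by rewrite /= uval_one rl // /turn mulr1 mulr0 cos2pi sin2pi cos0 sin0.
pose G l : {path I from config_incl x0 l to config_incl x0 l} :=
  path_fun (cr l) (r0 l) (r1 l).
pose y : pi1_prod R (config_incl x0) := fun l => \pi_(pi1 R (config_incl x0 l))
  (if l == i then G l else cst (config_incl x0 l) : {path I from _ to _}).
have [b _ bE] := surj y Logic.I.
have {bE} : forall l, strand_map R x0 b l = y l by rewrite bE.
elim/pi1_ind: b => p pE.
have {}pE l : path_homotopic (config_incl x0 l) (config_incl x0 l)
    (fun t => config_incl (p t) l)
    (if l == i then G l else cst (config_incl x0 l) : {path I from _ to _}).
  have := pE l; rewrite /strand_map !pi1_mapE => /pi1_eqP.
  exact.
have cp l : continuous (fun t => F (config_incl (p t) l)).
  apply: (comp_continuous cF).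
  apply: (@ptws_proj_continuous _ _ _ (fun t => config_incl (p t))).
  apply: (comp_continuous (@config_incl_continuous X n)); exact: cts_fun.
have p01 l : F (config_incl (p zero) l) = F (config_incl (p one) l).
  by rewrite path_zero path_one.
have lift_j : closed_lift (fun t => F (config_incl (p t) j)).
  have := path_homotopic_sym (pE j); rewrite /=.
  move=> /closed_lift_path_homotopic; apply.
  have [a _ [ca sa]] := cos_sin_surj (FC (config_incl x0 j)).
  exists (fun=> a); split=> //; first exact: cstr_continuous.
  by move=> s; rewrite /= ca sa -surjective_pairing.
have lift_i : closed_lift (fun t => F (config_incl (p t) i)).
  apply: (closed_lift_avoid (cp i) (cp j) (fun s => FC _) (p01 i) (p01 j)) lift_j.
  move=> s /val_inj /(can_inj fK); have := set_valP (p s).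
  by move=> /(_ i j isT).
have := closed_lift_path_homotopic (pE i) lift_i.
rewrite eqxx => -[a [ca a01 aE]].
apply: (rotate_turn_lift (FC (config_incl x0 i))).
by exists a; split=> // s; rewrite -aE /F /= gK.
Qed.

End circle_strands.
End winding.

(** * Arcs and cycles *)

Section vertex_sequence.
Context {R : realType} {V : finType} (K : simplicial_complex V).
Local Notation I := (unit_itv R).
Local Notation X := (realization R K).
Variables (o : X) (M : nat) (z : nat -> V).
Hypotheses (M_gt0 : (0 < M)%N)
  (zK : forall k, (k < M)%N -> adj K (z k) (z k.+1))
  (z_neq : forall k, (k < M)%N -> z k != z k.+1)
  (z_cover : forall x : X, exists2 k, (k < M)%N &
     supp x \subset [set z k; z k.+1]%SET).

Let h (r : R) : X := pt o (polygon M z r).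

Let bc_h (r : R) v : 0 <= r <= M%:R -> bc (h r) v = polygon M z r v.
Proof. by move=> rM; rewrite bc_pt //; exact: polygon_realization. Qed.

Let M_gt0R : 0 < M%:R :> R.
Proof. by rewrite ltr0n. Qed.

(** The point lies on a segment of the sequence, and its coordinate at the second end is its
    parameter there. *)
Lemma polygon_surj (x : X) : exists2 k, (k < M)%N &
  0 <= bc x (z k.+1) <= 1 /\
  (forall v, bc x v =
    mix (dirac (z k)) (dirac (z k.+1)) (bc x (z k.+1)) v) /\
  x = h (k%:R + bc x (z k.+1)).
Proof.
have [k kM xk] := z_cover x; exists k => //.
have x0 v : v \notin [set z k; z k.+1]%SET -> bc x v = 0.
  by move=> vk; apply/eqP; apply: contraNT vk => xv;
    apply: (fintype.subsetP xk); rewrite inE.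
have zz := z_neq kM.
have x1 : bc x (z k) + bc x (z k.+1) = 1.
  rewrite -(bc_sum x) (bigD1 (z k)) //= (bigD1 (z k.+1)) 1?eq_sym //= big1 ?addr0 //.
  by move=> v /andP[vk vk1]; apply: x0; rewrite !inE negb_or vk.
have b01 : 0 <= bc x (z k.+1) <= 1.
  by have := bc_ge0 x (z k); have := bc_ge0 x (z k.+1); lra.
have xE v : bc x v = mix (dirac (z k)) (dirac (z k.+1)) (bc x (z k.+1)) v.
  rewrite /mix /dirac; have [->|vk] := eqVneq v (z k).
    by rewrite (negbTE zz) /=; lra.
  have [->|vk1] := eqVneq v (z k.+1); first by rewrite /=; lra.
  by rewrite x0 ?inE ?negb_or ?vk //= !mulr0 addr0.
split=> //; split=> //.
apply/esym/pt_bc => v.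
rewrite (polygonE _ kM); last by rewrite -(natr1 k); lra.
by rewrite [RHS]xE; congr mix; rewrite addrAC subrr add0r.
Qed.

(** For distinct vertices [tau] inverts the parametrization [h] of the arc, and the contraction
    scales this parameter to 0. *)
Lemma polygon_contract : (forall i j, (i <= M)%N -> (j <= M)%N -> z i = z j -> i = j) ->
  exists G : X * I -> X, [/\ continuous G, forall x, G (x, zero) = x
    & forall x, G (x, one) = h 0].
Proof.
move=> z_inj; pose tau (x : X) : R := \sum_(j < M.+1) j%:R * bc x (z j).
have tauE x k : (k < M)%N -> 0 <= bc x (z k.+1) <= 1 ->
    (forall v, bc x v =
      mix (dirac (z k)) (dirac (z k.+1)) (bc x (z k.+1)) v) ->
    tau x = k%:R + bc x (z k.+1).
  move=> kM b01; move: (bc x (z k.+1)) b01 => b b01 xE.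
  transitivity (\sum_(j < M.+1) j%:R * tent (k%:R + b - j%:R)).
    apply: eq_bigr => j _; congr (_ * _); rewrite xE /mix /dirac /tent.
    have zE i : (i <= M)%N -> (z j == z i) = (j == i :> nat).
      move=> iM; apply/eqP/eqP => [/z_inj|->//]; apply=> //.
      by rewrite -ltnS.
    rewrite !zE ?(ltnW kM) //.
    have [->|jk] := eqVneq (j : nat) k.
      rewrite (ltn_eqF (ltnSn k)) addrAC subrr add0r ger0_norm; last by lra.
      by rewrite (max_idPr _) /=; lra.
    have [->|jk1] := eqVneq (j : nat) k.+1.
      rewrite -(natr1 k) ler0_norm; last by lra.
      by rewrite (max_idPr _) /=; lra.
    rewrite !mulr0 addr0 (max_idPl _) //.
    have [jk2|jk2] := ltnP j k.
      have : j.+1%:R <= k%:R :> R by rewrite ler_nat.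
      rewrite -(natr1 j) => jk3; rewrite ger0_norm; lra.
    have : k.+2%:R <= j%:R :> R.
      by rewrite ler_nat ltn_neqAle eq_sym jk1 ltn_neqAle eq_sym jk.
    rewrite -(natr1 k.+1) -(natr1 k) => jk3; rewrite ler0_norm; lra.
  rewrite (tent_sum (fun j => j%:R) kM); last by rewrite -(natr1 k); lra.
  by rewrite -(natr1 k); ring.
have tau_bound x : 0 <= tau x <= M%:R.
  have [k kM [b01 [xE _]]] := polygon_surj x; rewrite (tauE _ _ kM b01 xE).
  have k0 : 0 <= k%:R :> R by rewrite ler0n.
  have : k.+1%:R <= M%:R :> R by rewrite ler_nat.
  by rewrite -(natr1 k); lra.
have ctau : continuous tau.
  apply: sum_continuous => j; apply: mulr_continuous.
    exact: cstr_continuous.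
  exact: bc_continuous.
exists (fun xt => h ((1 - uval xt.2) * tau xt.1)); split.
- apply: pt_continuous => [[x t] /=|v].
    apply: polygon_realization => //.
    have := tau_bound x; have := uval01 t.
    by move: (tau x) (uval t) => a b ? ?; nra.
  apply: polygon_continuous; apply: mulr_continuous; first by solve_continuous.
  by apply: (comp_continuous ctau); exact: continuous_fst.
- move=> x /=; rewrite uval_zero subr0 mul1r.
  have [k kM [b01 [xE xh]]] := polygon_surj x.
  by rewrite (tauE _ _ kM b01 xE) -xh.
- by move=> x /=; rewrite uval_one subrr mul0r.
Qed.

(** The closed polygon and the standard parametrization of the circle both identify just the two
    ends of the interval. *)
Lemma polygon_circle : (2 < M)%N -> z M = z 0 ->
  (forall i j, (i < M)%N -> (j < M)%N -> z i = z j -> i = j) ->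
  homeomorphic X (circle R).
Proof.
move=> M3 zM z_inj.
have z_eq i j : (i <= M)%N -> (j <= M)%N -> z i = z j ->
    [\/ i = j, i = 0%N /\ j = M | i = M /\ j = 0%N].
  rewrite (leq_eqVlt i) (leq_eqVlt j) => /predU1P[->|iM] /predU1P[->|jM].
  - by constructor.
  - by rewrite zM => /(z_inj _ _ M_gt0 jM) <-; constructor 3.
  - by rewrite zM => /(z_inj _ _ iM M_gt0) ->; constructor 2.
  - by move/(z_inj _ _ iM jM) => ->; constructor.
have strict (r : R) : 0 <= r < M%:R ->
    exists2 k, (k < M)%N & k%:R <= r < k.+1%:R.
  move=> /andP[r0 rM]; have [|k kM /andP[kr rk]] := @nat_itv _ M r M_gt0.
    by rewrite r0 ltW.
  have [rk1|rk1] := ltP r k.+1%:R; first by exists k; rewrite ?kr.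
  have rE : r = k.+1%:R by apply/eqP; rewrite eq_le rk.
  exists k.+1; first by rewrite rE ltr_nat in rM.
  by rewrite rE lexx ltr_nat ltnSn.
have bcE (r : R) k v : (k < M)%N -> k%:R <= r < k.+1%:R ->
    bc (h r) v = mix (dirac (z k)) (dirac (z k.+1)) (r - k%:R) v.
  move=> kM kr; have k0 : 0 <= k%:R :> R by rewrite ler0n.
  have kM' : k.+1%:R <= M%:R :> R by rewrite ler_nat.
  rewrite bc_h; last by lra.
  by rewrite (polygonE _ kM) //; lra.
(* As [a < k + 1], the vertex [z k] has positive weight in [h a], so it must be an end of the
   segment containing [h b]. *)
have near_vertex (a b : R) k l : (k < M)%N -> (l < M)%N -> k%:R <= a < k.+1%:R ->
    l%:R <= b < l.+1%:R -> h a = h b -> z k = z l \/ z k = z l.+1.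
  move=> kM lM ka lb /(congr1 (bc ^~ (z k))) /=.
  rewrite (bcE a k) // (bcE b l) // /mix /dirac eqxx.
  have [|_] := eqVneq (z k) (z l); first by left.
  have [|_] := eqVneq (z k) (z l.+1); first by right.
  rewrite (negbTE (z_neq kM)) /= => ab.
  rewrite -(natr1 k) in ka; suff : (0 : R) < 0 by rewrite ltxx.
  by lra.
have h_inj (a b : R) : 0 <= a < M%:R -> 0 <= b < M%:R -> h a = h b -> a = b.
  move=> /strict [k kM ka] /strict [l lM lb] hab.
  (* Otherwise [z k = z (l + 1)] and [z l = z (k + 1)], and the cycle would have length at most
     two. *)
  have kl : k = l.
    have [|kl] := near_vertex _ _ _ _ kM lM ka lb hab; first exact: z_inj.
    have [/esym|lk] := near_vertex _ _ _ _ lM kM lb ka (esym hab); first exact: z_inj.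
    by case: (z_eq _ _ (ltnW kM) lM kl); case: (z_eq _ _ (ltnW lM) kM lk); lia.
  subst l; have := congr1 (bc ^~ (z k)) hab.
  rewrite /= (bcE a k) // (bcE b k) // /mix /dirac eqxx (negbTE (z_neq kM)) /=.
  lra.
have h0M : h 0 = h M%:R.
  have dirac_end k (r : R) : (k < M)%N -> r = k%:R \/ r = k.+1%:R ->
    polygon M z r = dirac (z (if r == k%:R then k else k.+1)).
    move=> kM rk; rewrite (polygonE _ kM); last first.
      by case: rk => ->; rewrite !ler_nat ?leqnn ?leqnSn.
    apply/funext => v; rewrite /mix; case: rk => ->.
      by rewrite eqxx subrr subr0 mul1r mul0r addr0.
    rewrite eqr_nat (gtn_eqF (ltnSn k)) -(natr1 k) addrAC subrr add0r.
    by rewrite subrr mul0r mul1r add0r.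
  have [M' ME] : exists M', M = M'.+1 by case: (M) M_gt0 => // M'; exists M'.
  rewrite /h (dirac_end 0%N) //; last by left.
  rewrite (dirac_end M') ?ME //; last by right.
  rewrite eqr_nat eqxx (gtn_eqF (ltnSn M')).
  by congr (pt o (dirac _)); rewrite -zM ME.
pose f (t : I) : X := h (M%:R * uval t).
have Mt01 (t : I) : 0 <= M%:R * uval t <= M%:R.
  by rewrite mulr_ge0 ?uval_ge0 ?(ltW M_gt0R) //= ler_piMr ?uval_le1 ?(ltW M_gt0R).
have f01 : f zero = f one by rewrite /f uval_zero uval_one mulr0 mulr1.
have f_inj s t : uval s < 1 -> uval t < 1 -> f s = f t -> s = t.
  move=> s1 t1 /h_inj st; apply: uval_inj.
  have bound (u : I) : uval u < 1 -> 0 <= M%:R * uval u < M%:R.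
    move=> u1; have /andP[-> _] := Mt01 u.
    by rewrite gtr_pMr.
  by have /(mulfI (lt0r_neq0 M_gt0R)) := st (bound _ s1) (bound _ t1).
have one_or (t : I) : t = one \/ uval t < 1.
  have := uval_le1 t; rewrite le_eqVlt => /predU1P[t1|]; last by right.
  by left; apply: uval_inj; rewrite uval_one.
have zero_lt1 : uval (zero : I) < 1 by rewrite uval_zero.
apply: (quotient_homeomorphic (f := f) (g := @circle_param R)).
- exact: unit_itv_compact.
- apply: (@hausdorff_injective _ {ptws V -> R} set_val).
  + exact: set_val_continuous.
  + exact: val_inj.
  + by apply: hausdorff_product => v; exact: Rhausdorff.
- exact: circle_hausdorff.
- apply: pt_continuous => [t|v]; first exact: polygon_realization.
  by apply: polygon_continuous; solve_continuous.
- exact: circle_param_continuous.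
- move=> x; have [k kM [b01 [_ xE]]] := polygon_surj x.
  have k0 : 0 <= k%:R :> R by rewrite ler0n.
  have kM' : k.+1%:R <= M%:R :> R by rewrite ler_nat.
  exists (clamp ((k%:R + bc x (z k.+1)) / M%:R)); rewrite /f uval_clamp_id.
  + by rewrite mulrC divfK ?lt0r_neq0 // -xE.
  + by rewrite divr_ge0 ?(ltW M_gt0R) //; lra.
  + by rewrite ler_pdivrMr // mul1r; rewrite -(natr1 k) in kM'; lra.
- exact: circle_param_surj.
move=> s t; rewrite circle_param_eq; split=> [fst|[->//|[-> ->]//|[-> ->]//]].
have [s1|s1] := one_or s; have [t1|t1] := one_or t.
- by constructor 1; rewrite s1 t1.
- by constructor 3; split=> //; apply/esym/f_inj => //; rewrite f01 -s1.
- by constructor 2; split=> //; apply: f_inj => //; rewrite fst t1 -f01.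
- by constructor 1; exact: f_inj.
Qed.

End vertex_sequence.

(** * Complexes whose vertices have at most two neighbours *)

Section low_degree.
Context {R : realType} {V : finType} (K : simplicial_complex V).
Local Notation X := (realization R K).
Variable o : X.
Hypothesis connectedX : connected [set: X].

Definition nbr w : {set V} := [set u | (u != w) && adj K w u]%SET.

Lemma vertex_closed_all (P : pred V) v0 : [set v0]%SET \in K -> P v0 ->
  (forall u v, P u -> adj K u v -> P v) ->
  forall v, [set v]%SET \in K -> P v.
Proof.
move=> v0K Pv0 Pcl v vK.
have /connectP [p] := vertex_connect o connectedX v0K vK.
elim: p v0 {v0K} Pv0 => [v0 Pv0 _ -> //|u p IH v0 Pv0 /= /andP[v0u up]].
by apply: IH => //; exact: Pcl v0u.
Qed.

Lemma fork_of_degree w : (2 < #|nbr w|)%N ->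
  exists u1 u2 u3, [/\ fork K w u1 u2, fork K w u3 u2 & u1 != u3].
Proof.
move=> /card_gt2P [u1 [u2 [u3 [[]]]]].
rewrite !inE => /andP[u1w wu1] /andP[u2w wu2] /andP[u3w wu3] [u12 u23 u31].
exists u1, u2, u3; split; last by rewrite eq_sym.
- by split=> //; rewrite eq_sym.
- by split=> //; rewrite eq_sym.
Qed.

Hypothesis degree2 : forall w, (#|nbr w| <= 2)%N.

(** Each vertex of [s] has its two permitted neighbours inside [s] already, so [s] is closed under
    adjacency. *)
Lemma big_simplex_all (s : {set V}) : s \in K -> (2 < #|s|)%N ->
  forall v, [set v]%SET \in K -> v \in s.
Proof.
move=> sK s3; have /set0Pn [v0 v0s] := simplex_neq0 sK.
apply: (vertex_closed_all (P := fun v => v \in s) (v0 := v0)) => // [|u v us uv].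
  by apply: (@adj_vertex _ K v0 v0); exact: (simplex_adj sK).
have [->//|vu] := eqVneq v u.
have sub : (s :\ u)%SET \subset nbr u.
  apply/fintype.subsetP => x; rewrite !inE => /andP[-> xs] /=.
  exact: (simplex_adj sK).
have : (s :\ u)%SET == nbr u.
  rewrite eqEcard sub /=; apply: leq_trans (degree2 u) _.
  by rewrite (cardsD1 u) us in s3.
move=> /eqP nE; have : v \in nbr u by rewrite inE vu.
by rewrite -nE !inE => /andP[].
Qed.

Let e : rel V := fun u v => (u != v) && adj K u v.

Let e_sym u v : e u v = e v u.
Proof. by rewrite /e eq_sym adj_sym. Qed.

(** In a simple path of maximal length, a neighbour of an end that was off the path would extend
    it. *)
Lemma longest_path u0 u1 : u0 != u1 -> adj K u0 u1 ->
  exists m (z : nat -> V), [/\ (0 < m)%N,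
    forall i j, (i <= m)%N -> (j <= m)%N -> z i = z j -> i = j,
    forall k, (k < m)%N -> adj K (z k) (z k.+1) &
    forall u, (e (z 0) u -> exists2 k, (k <= m)%N & u = z k) /\
      (e (z m) u -> exists2 k, (k <= m)%N & u = z k)].
Proof.
move=> u01 adj01.
pose L m := exists x p, [/\ path e x p, uniq (x :: p) & size p = m].
have L1 : L 1%N.
  exists u0, [:: u1]; split=> //=; first by rewrite /e u01 adj01.
  by rewrite inE u01.
have LV m : `[< L m >] -> (m <= #|V|)%N.
  move=> /asboolP [x [p [_ /card_uniqP /= pE <-]]].
  by apply: leq_trans (max_card (mem (x :: p))); rewrite pE.
have exL : exists m, `[< L m >] by exists 1%N; exact/asboolP.
case: (ex_maxnP exL LV) => m /asboolP [x [p [xp up pm]]] mmax.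
have m1 : (0 < m)%N by apply: (mmax 1%N); exact/asboolP.
have maxL q y : path e y q -> uniq (y :: q) -> (size q <= m)%N.
  by move=> yq uq; apply: mmax; apply/asboolP; exists y, q.
exists m, (nth x (x :: p)); split=> //.
- by move=> i j im jm /eqP; rewrite nth_uniq /= ?pm ?ltnS // => /eqP.
- move=> k km; move/pathP: xp => /(_ x k); rewrite pm => /(_ km).
  by rewrite /e => /andP[].
move=> u; have inp : u \in x :: p -> exists2 k, (k <= m)%N & u = nth x (x :: p) k.
  move=> upx; exists (index u (x :: p)); last by rewrite nth_index.
  by rewrite -ltnS -pm -[(size p).+1]/(size (x :: p)) index_mem.
split=> eu; apply: inp; apply: contraT => unp.
- have := maxL (x :: p) u; rewrite [path _ _ _]/= [uniq _]/= => H.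
  have : (size (x :: p) <= m)%N.
    apply: H; first by rewrite e_sym eu xp.
    by rewrite unp.
  by rewrite /= pm ltnn.
- have := maxL (rcons p u) x; rewrite rcons_path xp -rcons_cons rcons_uniq unp up.
  rewrite size_rcons pm ltnn => H; apply: H => //.
  by move: eu; rewrite -pm -[X in nth _ _ X]/((size (x :: p)).-1) nth_last.
Qed.

Lemma low_degree_alternative :
  (1 <= complex_dim K)%N -> homeomorphic X (circle R) \/
  forall n (c : {ptws 'I_n -> X}), config_space X n c -> full R c.
Proof.
move=> dimK.
have [[s /andP[sK s3]]|small] := pselect (exists s, (s \in K) && (2 < #|s|)%N).
  right=> n c; have /set0Pn [w ws] := simplex_neq0 sK.
  have xs (x : X) : supp x \subset s.
    apply/fintype.subsetP => v vx; apply: (big_simplex_all sK s3).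
    exact: supp_vertex vx.
  have wst (x : X) : cstar w x.
    apply: (simplex_sub sK); first by apply/set0Pn; exists w; rewrite !inE eqxx.
    by rewrite finset.subUset finset.sub1set ws xs.
  apply: (@full_contract _ _ _ (fun xt => seg o xt.1 (vertex o w) (uval xt.2))
    (vertex o w)) => [|x|x] /=.
  - apply: seg_continuous; try solve_continuous.
    + by move=> t; exact: cstar_joinable.
    + by move=> t; exact: uval01.
  - by rewrite uval_zero seg0.
  - by rewrite uval_one seg1.
have {}small s : s \in K -> (#|s| <= 2)%N.
  by move=> sK; rewrite leqNgt; apply/negP => s3; apply: small; exists s; rewrite sK.
have [s sK s2] : exists2 s, s \in K & (1 < #|s|)%N.
  apply: contrapT => nos; move: dimK; apply/negP; rewrite -ltnNge ltnS.
  apply/bigmax_leqP => s sK; rewrite -subn1 leq_subLR addn0 leqNgt.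
  by apply/negP => s2; apply: nos; exists s.
have /card_gt1P [u0 [u1 [u0s u1s u01]]] := s2.
have [m [z [m_gt0 z_inj zK z_end]]] :=
  longest_path u01 (simplex_adj sK u0s u1s).
have z_neq i j : (i <= m)%N -> (j <= m)%N -> i != j -> z i != z j.
  by move=> im jm; apply: contraNneq => /z_inj ->.
(* An inner vertex of the path has its two permitted neighbours next to it on the path; for the ends
   maximality is used. Hence the path exhausts all vertices. *)
have z_in k u : (k <= m)%N -> e (z k) u ->
    [\/ (k < m)%N /\ u = z k.+1, (0 < k)%N /\ u = z k.-1 |
     (k = 0%N \/ k = m) /\ exists2 l, (l <= m)%N & u = z l].
  move=> km ku; have [k0|k0] := posnP k.
    by constructor 3; split; [left|rewrite k0 in ku; exact: (z_end u).1].
  have [km'|km'] := ltnP k m; last first.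
    have kE : k = m by apply/eqP; rewrite eqn_leq km.
    by constructor 3; split; [right|rewrite kE in ku; exact: (z_end u).2].
  have sub : [set z k.-1; z k.+1]%SET \subset nbr (z k).
    apply/fintype.subsetP => v; rewrite !inE => /orP[] /eqP ->.
      rewrite z_neq //=; [|lia|lia].
      by have := zK k.-1; rewrite prednK // adj_sym => ->.
    by rewrite z_neq //= ?(gtn_eqF (ltnSn k)) // zK.
  have : [set z k.-1; z k.+1]%SET == nbr (z k).
    by rewrite eqEcard sub cards2 z_neq ?degree2 //; lia.
  move=> /eqP nE; have : u \in nbr (z k) by move: ku; rewrite inE /e eq_sym.
  by rewrite -nE !inE => /orP[] /eqP ->; [constructor 2|constructor 1].
have z_all v : [set v]%SET \in K -> exists2 k, (k <= m)%N & v = z k.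
  move=> vK; apply/asboolP; move: v vK.
  apply: (@vertex_closed_all (fun v => `[< exists2 k, (k <= m)%N & v = z k >])
    (z 0)).
  - by apply: (@adj_vertex _ K (z 0) (z 1)); exact: zK.
  - by apply/asboolP; exists 0%N.
  - move=> u v /asboolP [k km ->] kv; apply/asboolP.
    have [->|zv] := eqVneq v (z k); first by exists k.
    have [|[km' ->]|[k0 ->]|[_]//] := z_in k v km.
    + by rewrite /e eq_sym zv.
    + by exists k.+1.
    + by exists k.-1 => //; exact: leq_trans (leq_pred k) km.
have z_adj i j : (i < j)%N -> (j <= m)%N -> adj K (z i) (z j) ->
    j = i.+1 \/ (i = 0%N /\ j = m).
  move=> ij jm zij; have im : (i <= m)%N := leq_trans (ltnW ij) jm.
  have eij : e (z i) (z j) by rewrite /e zij andbT z_neq // ltn_eqF.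
  have eji : e (z j) (z i) by rewrite e_sym.
  case: (z_in _ _ im eij) => [[im' /z_inj H]|[i0 /z_inj H]|[i0m _]].
  - by left; exact: H.
  - by have := H jm (leq_trans (leq_pred i) im); lia.
  - case: (z_in _ _ jm eji) => [[jm' /z_inj H]|[j0 /z_inj H]|[j0m _]].
    + by have := H im jm'; lia.
    + by have := H im (leq_trans (leq_pred j) jm); lia.
    + by right; lia.
(* The case [i = j] records a vertex, for which an edge of the path through it is chosen later. *)
have cover (x : X) : exists i j, [/\ (i <= j)%N, (j <= m)%N, adj K (z i) (z j)
    & supp x \subset [set z i; z j]%SET].
  have xK := supp_simplex x; have [v vx] := supp_neq0 x.
  have [i im vE] := z_all v (supp_vertex vx).
  have [xv|] := eqVneq (supp x) [set v]%SET.
    exists i, i; split=> //; first by rewrite -vE; exact: (simplex_adj xK).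
    by rewrite xv vE; apply/fintype.subsetP => u; rewrite !inE => ->.
  move=> xv; have [u ux uv] : exists2 u, u \in supp x & u != v.
    apply: contrapT => nou; move/eqP: xv; apply; apply/eqP.
    rewrite finset.eqEsubset finset.sub1set vx andbT; apply/fintype.subsetP => u ux.
    by rewrite inE; apply/negPn/negP => uv; apply: nou; exists u.
  have [j jm uE] := z_all u (supp_vertex ux).
  have xE : supp x = [set v; u]%SET.
    apply/esym/eqP; rewrite eqEcard finset.subUset !finset.sub1set vx ux /=.
    by rewrite cards2 eq_sym uv; exact: small.
  have vu : adj K v u := simplex_adj xK vx ux.
  have [ij|ji] := leqP i j.
    by exists i, j; rewrite -vE -uE xE.
  by exists j, i; rewrite -vE -uE xE finset.setUC adj_sym (ltnW ji).
(* For [m = 1] the two ends are adjacent by the edge of the path itself, which closes no cycle. *)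
have [closing|open_path] := boolP ((1 < m)%N && adj K (z 0) (z m)).
  left; have [m2 zm0] := andP closing.
  (* The path followed by a return to its start, of length [m + 1 > 2]. *)
  pose y k := if k == m.+1 then z 0%N else z k.
  have yE k : (k <= m)%N -> y k = z k by move=> km; rewrite /y ltn_eqF.
  have yM : y m.+1 = z 0 by rewrite /y eqxx.
  apply: (@polygon_circle _ _ K o m.+1 y) => //.
  - move=> k; rewrite ltnS => km; rewrite yE //.
    have [->|km'] := eqVneq k m; first by rewrite yM adj_sym.
    by rewrite yE ?zK // ltn_neqAle km'.
  - move=> k; rewrite ltnS => km; rewrite yE //.
    have [->|km'] := eqVneq k m; first by rewrite yM z_neq // -lt0n.
    have km2 : (k < m)%N by rewrite ltn_neqAle km'.
    by rewrite yE // z_neq // ltn_eqF.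
  - move=> x; have [i [j [ij jm zij xij]]] := cover x.
    have [ijE|ij'] := eqVneq i j.
      exists i; first by rewrite ltnS (leq_trans ij).
      apply: fintype.subset_trans xij _; rewrite -ijE yE ?(leq_trans ij) //.
      by apply/fintype.subsetP => v; rewrite !inE orbb => ->.
    have {}ij : (i < j)%N by rewrite ltn_neqAle ij'.
    have [jE|[iE jE]] := z_adj i j ij jm zij.
      by exists i; [lia|rewrite !yE -?jE //; exact: ltnW (leq_trans ij jm)].
    exists m => //; rewrite yM yE //; apply: fintype.subset_trans xij _.
    by rewrite iE jE finset.setUC.
  - by move=> i j; rewrite !ltnS => im jm; rewrite !yE //; exact: z_inj.
right=> n c.
have [|x|G [cG G0 G1]] := @polygon_contract _ _ K o m z m_gt0 zK _ _ z_inj.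
- by move=> k km; rewrite z_neq ?(ltnW km) // ltn_eqF.
- have [i [j [ij jm zij xij]]] := cover x.
  have [ijE|ij'] := eqVneq i j.
    have [im|im] := ltnP i m.
      exists i => //; apply: fintype.subset_trans xij _; rewrite -ijE.
      by apply/fintype.subsetP => v; rewrite !inE orbb => ->.
    have iE : i = m by lia.
    exists m.-1; first by lia.
    rewrite prednK //; apply: fintype.subset_trans xij _; rewrite -ijE iE.
    by apply/fintype.subsetP => v; rewrite !inE orbb => ->; rewrite orbT.
  have {}ij : (i < j)%N by rewrite ltn_neqAle ij'.
  have [jE|[iE jE]] := z_adj i j ij jm zij.
    by exists i; [lia|rewrite -jE].
  exists 0%N => //; suff m1 : m = 1%N by move: xij; rewrite iE jE m1.
  apply/eqP; rewrite eqn_leq m_gt0 andbT leqNgt; apply: contra open_path => m2.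
  by move: zij; rewrite m2 iE jE.
- exact: full_contract cG G0 G1.
Qed.

End low_degree.

Theorem theorem4p6 (R : realType) (V : finType) (K : simplicial_complex V)
    (n : nat) (x0 : config_space (realization R K) n)
    (connectedK : connected [set: realization R K])
    (dimK : (1 <= complex_dim K)%N) (n_ge2 : (2 <= n)%N) :
  set_surj [set: pure_braid_group R x0] [set: pi1_prod R (config_incl x0)]
    (strand_map R x0)
  <-> ~ homeomorphic (realization R K) (circle R).
Proof.
split=> [surj [f [g [cf cg fK gK]]]|not_circle].
  exact: (circle_strand_map_not_surj cf cg fK gK n_ge2 surj).
apply: full_strand_map_surj; have Fx0 := set_valP x0.
(* Any point serves as the default value of [pt]. *)
pose o := config_incl x0 (Ordinal (ltnW n_ge2)).
have [[w w3]|low] := pselect (exists w, (2 < #|nbr K w|)%N); last first.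
  have low2 w : (#|nbr K w| <= 2)%N.
    by rewrite leqNgt; apply/negP => w3; apply: low; exists w.
  have [/not_circle //|] := low_degree_alternative o connectedK low2 dimK.
  exact.
have [u1 [u2 [u3 [f12 f32 u13]]]] := fork_of_degree w3.
have [d x0d dE] := gather o connectedK f12 Fx0.
have /choice [s sP] : forall j, exists r : R, 0 < r < 1 /\
    d j = line o w u1 u2 r.
  by move=> j; have [r] := dE j; exists r.
have ds : d = fun j => line o w u1 u2 (s j) by apply/funext => j; exact: (sP j).2.
have s_inj : injective s.
  move=> i j sij; apply/eqP/negPn/negP => ij.
  by apply: (conn_config x0d ij); rewrite ds sij.
apply: (full_conn x0d); rewrite ds.
exact: (@full_line _ _ _ o _ _ _ _ f12 f32 u13 _ _ s_inj (fun j => (sP j).1)).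
Qed.
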